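(* Let $n\geq 2$. The algebra $k\mathbb{D}_n^1$ is Morita equivalent to the $k$-algebra of the following quiver with relations. The vertices are $2,3,\dots,n$ (top row) and $1=1',2',3',\dots,(n-1)'$ (bottom row). The arrows are $d:j\to j-1$ for $3\le j\le n$, $a:j'\to(j-1)'$ for $2\le j\le n-1$, $c:j\to(j-1)'$ for $2\le j\le n$, and a loop $t$ on each top vertex $j$, $2\le j\le n$. The relations (wherever defined) are $$t^2=e_*,\quad tdt=d,\quad (c-ct)d=a(c-ct),\quad dd=0,\quad aa=0,$$ where $e_*$ is the trivial path at the relevant vertex and paths compose right to left.
   Context: $k$ is a PID; quiver representations below are taken over a fixed field. Quivers. $A_m$ is $1\to2\to\cdots\to m$. For $m\ge3$, $D_m$ is the quiver with vertices $1,\dots,m$ and arrows $1\to3$, $2\to3$, and $j\to j+1$ for $3\le j<m$. $\mathrm{Mod}(Q)$ is the category of finite-dimensional representations of $Q$. Functors. For a non-sink vertex $i$ of $Q=A_m$ or $D_m$, $\pi_i$ (the orthogonal projection from the simple representation $S_i$) is the contraction at $i$: it deletes the vertex $i$, replaces each pair of arrows $u\to i\to v$ by an arrow $u\to v$ carrying the composite map, and renumbers each vertex $j>i$ as $j-1$. Thus $\pi_i:\mathrm{Mod}(A_m)\to\mathrm{Mod}(A_{m-1})$ for $1\le i\le m-1$; $\pi_i:\mathrm{Mod}(D_m)\to\mathrm{Mod}(D_{m-1})$ for $3\le i\le m-1$; and $\pi_1,\pi_2:\mathrm{Mod}(D_m)\to\mathrm{Mod}(A_{m-1})$. The functor $\iota_i$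 is the right adjoint of $\pi_i$: it inserts a new vertex $i$ before the vertex which was its target, puts at $i$ the same vector space as at that target, with the identity on the arrow leaving $i$, and with the arrows entering $i$ carrying the maps formerly entering the target (through $i$). The functor $t:\mathrm{Mod}(D_m)\to\mathrm{Mod}(D_m)$ exchanges the vertices $1$ and $2$. The configuration. $\mathbb{D}_n^1$ is the quiver exceptional configuration (with dimension vectors, all equal to $(1,\dots,1)$, i.e. that of the injective $I$ at the sink) rooted at $(D_{n+1},I_{n+1})$ and compressedly generated by $S_1,\dots,S_n$, completed by sections to the maximal GReedy one. Explicitly, it is a quiver $\Gamma$ with vertices $D_3,\dots,D_{n+1}$ and $A_2,\dots,A_n$, and arrows labelled by functors: the loop $t$ on each $D_m$; $\pi_3,\dots,\pi_{m-1}:D_m\to D_{m-1}$ and $\iota_3,\dots,\iota_{m-2}:D_{m-1}\to D_m$ for $4\le m\le n+1$; $\pi_1,\pi_2:D_m\to A_{m-1}$ for $3\le m\le n+1$; and $\pi_1,\dots,\pi_{m-1}:A_m\to A_{m-1}$, $\iota_1,\dots,\iota_{m-2}:A_{m-1}\to A_m$ for $3\le m\le n$. The algebra $k\mathbb{D}_n^1$ is the path algebra $k\Gamma$ modulo the ideal generated by all differences $p_1-p_2$ of parallel paths whose evaluations as functors agree up to natural isomorphism. *)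

(* Defs.v *)
From HB Require Import structures.
From mathcomp Require Import all_boot all_order all_algebra.
From mathcomp Require Import boolp.
From mathcomp Require Import finmap.
From mathcomp.multinomials Require Import monalg.
From mathcomp Require Import zify.

Set Implicit Arguments.
Unset Strict Implicit.
Unset Printing Implicit Defensive.

Import GRing.Theory.
Local Open Scope ring_scope.
Local Open Scope quotient_scope.

#[local] Obligation Tactic := idtac.

Definition is_PID (k : idomainType) : Prop :=
  forall I : k -> Prop,
    I 0 -> (forall x y, I x -> I y -> I (x + y)) ->
    (forall a x, I x -> I (a * x)) ->
    exists g, forall x, I x <-> exists a, x = a * g.

Section Categories.

Record category := Category {
  obj :> Type;
  hom : obj -> obj -> Type;
  idm : forall X, hom X X;
  cmp : forall X Y Z, hom Y Z -> hom X Y -> hom X Z;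
  cmp1m : forall X Y (f : hom X Y), cmp (idm Y) f = f;
  cmpm1 : forall X Y (f : hom X Y), cmp f (idm X) = f;
  cmpA : forall X Y Z T (h : hom Z T) (g : hom Y Z) (f : hom X Y),
    cmp h (cmp g f) = cmp (cmp h g) f }.

Record functor (C D : category) := Functor {
  fobj :> C -> D;
  fmap : forall X Y : C, hom X Y -> hom (fobj X) (fobj Y);
  fmap1 : forall X : C, fmap (idm X) = idm (fobj X);
  fmapM : forall (X Y Z : C) (g : hom Y Z) (f : hom X Y),
    fmap (cmp g f) = cmp (fmap g) (fmap f) }.

Definition fid (C : category) : functor C C :=
  @Functor C C id (fun _ _ f => f) (fun=> erefl) (fun _ _ _ _ _ => erefl).

Program Definition fcomp (C D E : category)
    (G : functor D E) (F : functor C D) : functor C E :=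
  @Functor C E (fun X => G (F X)) (fun _ _ f => fmap G (fmap F f)) _ _.
Next Obligation. by move=> C D E G F X /=; rewrite !fmap1. Qed.
Next Obligation. by move=> C D E G F X Y Z g f /=; rewrite !fmapM. Qed.

Definition is_iso (C : category) (X Y : C) (f : hom X Y) : Prop :=
  exists g : hom Y X, cmp g f = idm X /\ cmp f g = idm Y.

Definition nat_iso (C D : category) (F G : functor C D) : Prop :=
  exists eta : forall X : C, hom (F X) (G X),
    (forall X, is_iso (eta X)) /\
    (forall (X Y : C) (f : hom X Y),
       cmp (eta Y) (fmap F f) = cmp (fmap G f) (eta X)).

End Categories.

Section ModuleCategory.
Variable A : pzRingType.

Lemma linear_ext (M N : lmodType A) (f g : {linear M -> N}) : f =1 g -> f = g.
Proof.
case: f g => [f [[f1] [f2]]] [g [[g1] [g2]]] /= /funext fg.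
case: _ / fg g1 g2 => g1 g2.
by rewrite (Prop_irrelevance f1 g1) (Prop_irrelevance f2 g2).
Qed.

Program Definition lmod_cat : category := @Category (lmodType A)
  (fun M N => {linear M -> N})
  (fun M => idfun : {linear M -> M})
  (fun M N P g f => (g \o f)%FUN : {linear M -> P}) _ _ _.
Next Obligation. by move=> X Y f; apply: linear_ext. Qed.
Next Obligation. by move=> X Y f; apply: linear_ext. Qed.
Next Obligation. by move=> X Y Z T h g f; apply: linear_ext. Qed.

End ModuleCategory.

(* An associative unital ring with a ring morphism from [k] to its center;
   unlike [algType k], this does not presuppose [1 != 0]. *)
Record algebra (k : comPzRingType) := Algebra {
  alg_ring :> pzRingType;
  alg_map : {rmorphism k -> alg_ring};
  alg_central : forall c x, alg_map c * x = x * alg_map c }.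

Section Morita.
Variable k : comPzRingType.

(* [A]-modules are [k]-modules through [alg_map A]; the hypothesis says
   [h = c *: f + g], where the [A]-linear maps [M -> N] have no canonical
   [k]-module structure in the library. *)
Definition klinear (A B : algebra k)
    (F : functor (lmod_cat A) (lmod_cat B)) : Prop :=
  forall (M N : lmodType A) (c : k) (f g h : {linear M -> N}),
    (forall x, h x = alg_map A c *: f x + g x) ->
    forall y, @fmap _ _ F M N h y
      = alg_map B c *: @fmap _ _ F M N f y + @fmap _ _ F M N g y.

Definition morita_equivalent (A B : algebra k) : Prop :=
  exists (F : functor (lmod_cat A) (lmod_cat B))
         (G : functor (lmod_cat B) (lmod_cat A)),
    [/\ klinear F, klinear G,
        nat_iso (fcomp G F) (fid (lmod_cat A)) &
        nat_iso (fcomp F G) (fid (lmod_cat B))].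

End Morita.

Section IdealQuotient.

Definition two_sided_ideal (A : pzRingType) (J : A -> Prop) : Prop :=
  [/\ J 0, forall x y, J x -> J y -> J (x + y) &
      forall a b x, J x -> J (a * x * b)].

Definition ideal_gen (A : pzRingType) (R : A -> Prop) : {pred A} := fun x =>
  `[< forall J, two_sided_ideal J -> (forall r, R r -> J r) -> J x >].

Variables (A : pzRingType) (R : A -> Prop).
Local Notation I := (ideal_gen R).

Lemma ideal_genP : two_sided_ideal (fun x => x \in I).
Proof.
split.
- by apply/asboolP => J [].
- move=> x y /asboolP Ix /asboolP Iy; apply/asboolP => J idJ RJ.
  by case: (idJ) => _ + _; apply; [apply: Ix|apply: Iy].
- move=> a b x /asboolP Ix; apply/asboolP => J idJ RJ.
  by case: (idJ) => _ _; apply; apply: Ix.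
Qed.

Lemma ideal_gen_zmod : zmod_closed I.
Proof.
case: ideal_genP => I0 ID IM; split=> // x y Ix Iy; apply: ID => //.
by rewrite -[- y]mulr1 -mulN1r; apply: IM.
Qed.

HB.instance Definition _ := GRing.isZmodClosed.Build A I ideal_gen_zmod.

Definition iquot := Quotient.quot I.
HB.instance Definition _ := GRing.Zmodule.on iquot.

Definition iquot_pi (x : A) : iquot := \pi_(Quotient.quot I) x.

Lemma iquot_piP x y : (iquot_pi x = iquot_pi y) <-> (x - y \in I).
Proof. by rewrite Quotient.idealrBE; split=> /eqP. Qed.

Lemma iquot_repr (x : iquot) : iquot_pi (repr x) = x.
Proof. exact: reprK. Qed.

Lemma iquot_piD x y : iquot_pi (x + y) = iquot_pi x + iquot_pi y.
Proof. exact: (Quotient.pi_add). Qed.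

Definition iquot_mul (x y : iquot) : iquot := iquot_pi (repr x * repr y).

Lemma iquot_piM x y : iquot_pi (x * y) = iquot_mul (iquot_pi x) (iquot_pi y).
Proof.
case: ideal_genP => I0 ID IM; apply/iquot_piP.
set x' := repr _; set y' := repr _.
have Ix : x - x' \in I by apply/iquot_piP; rewrite iquot_repr.
have Iy : y - y' \in I by apply/iquot_piP; rewrite iquot_repr.
have -> : x * y - x' * y' = 1 * (x - x') * y + x' * (y - y') * 1.
  by rewrite mul1r mulr1 mulrBl mulrBr addrA subrK.
by apply: ID; apply: IM.
Qed.

Lemma iquot_mulA : associative iquot_mul.
Proof.
move=> x y z; rewrite -[x]iquot_repr -[y]iquot_repr -[z]iquot_repr.
by rewrite -!iquot_piM mulrA.
Qed.

Lemma iquot_mul1r : left_id (iquot_pi 1) iquot_mul.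
Proof. by move=> x; rewrite -[x]iquot_repr -iquot_piM mul1r. Qed.

Lemma iquot_mulr1 : right_id (iquot_pi 1) iquot_mul.
Proof. by move=> x; rewrite -[x]iquot_repr -iquot_piM mulr1. Qed.

Lemma iquot_mulDl : left_distributive iquot_mul +%R.
Proof.
move=> x y z; rewrite -[x]iquot_repr -[y]iquot_repr -[z]iquot_repr.
by rewrite -iquot_piD -!iquot_piM mulrDl iquot_piD.
Qed.

Lemma iquot_mulDr : right_distributive iquot_mul +%R.
Proof.
move=> x y z; rewrite -[x]iquot_repr -[y]iquot_repr -[z]iquot_repr.
by rewrite -iquot_piD -!iquot_piM mulrDr iquot_piD.
Qed.

HB.instance Definition _ := GRing.Zmodule_isPzRing.Build iquot
  iquot_mulA iquot_mul1r iquot_mulr1 iquot_mulDl iquot_mulDr.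

Lemma iquot_pi_zmod : zmod_morphism iquot_pi.
Proof.
move=> x y; apply/eqP; rewrite eq_sym subr_eq; apply/eqP.
by rewrite -iquot_piD subrK.
Qed.

Lemma iquot_pi_monoid : monoid_morphism iquot_pi.
Proof. by split=> // x y; rewrite iquot_piM. Qed.

HB.instance Definition _ := GRing.isZmodMorphism.Build A iquot iquot_pi
  iquot_pi_zmod.
HB.instance Definition _ := GRing.isMonoidMorphism.Build A iquot iquot_pi
  iquot_pi_monoid.

End IdealQuotient.

Program Definition quotient_algebra (k : comPzRingType) (A : algebra k)
    (R : A -> Prop) : algebra k :=
  @Algebra k (iquot R) (iquot_pi R \o alg_map A : {rmorphism k -> iquot R}) _.
Next Obligation.
move=> k A R c x /=; rewrite -[x]iquot_repr -!(rmorphM (iquot_pi R)).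
by rewrite alg_central.
Qed.

(* Paths compose right to left: [pcons a p] is [p] followed by [a]. *)
Inductive qpath (V : Type) (E : V -> V -> Type) (x : V) : V -> Type :=
| pnil : qpath E x x
| pcons y z (a : E y z) (p : qpath E x y) : qpath E x z.
Arguments pnil {V E x}.

Section Paths.
Variables (V : Type) (E : V -> V -> Type).

Definition parrow x y (a : E x y) : qpath E x y := pcons a pnil.

Fixpoint pcat x y z (q : qpath E y z) : qpath E x y -> qpath E x z :=
  match q with
  | pnil => fun p => p
  | pcons _ _ a q' => fun p => pcons a (pcat q' p)
  end.

Lemma pcatp0 x y (p : qpath E x y) : pcat p pnil = p.
Proof. by elim: p => //= z t a p ->. Qed.

Lemma pcatA x y z t (r : qpath E z t) (q : qpath E y z) (p : qpath E x y) :
  pcat r (pcat q p) = pcat (pcat r q) p.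
Proof. by elim: r q => //= u v a r IH q; rewrite IH. Qed.

Record tpath := TPath { tsrc : V; ttgt : V; tpth : qpath E tsrc ttgt }.

HB.instance Definition _ := gen_eqMixin tpath.
HB.instance Definition _ := gen_choiceMixin tpath.

End Paths.

Section PathAlgebra.
Variables (k : comNzRingType) (V : finType) (E : V -> V -> Type).

Definition palg : Type := {malg k[tpath E]}.
HB.instance Definition _ := GRing.Lmodule.on palg.

Definition basis x y (p : qpath E x y) : palg := << TPath p >>.

Definition tmul (q p : tpath E) : palg :=
  match ttgt p =P tsrc q with
  | ReflectT e => basis (pcat (tpth q) (ecast y (qpath E _ y) e (tpth p)))
  | ReflectF _ => 0
  end.

Definition palg_mul (f g : palg) : palg :=
  \sum_(q <- msupp f) \sum_(p <- msupp g) (f@_q * g@_p) *: tmul q p.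

Definition palg_one : palg := \sum_(x : V) basis (@pnil V E x).

Definition lext (W : lmodType k) (h : tpath E -> W) (f : palg) : W :=
  \sum_(p <- msupp f) f@_p *: h p.

Lemma lextEw (W : lmodType k) (h : tpath E -> W) (f : palg)
    (d : {fset tpath E}) : (msupp f `<=` d)%fset ->
  lext h f = \sum_(p <- d) f@_p *: h p.
Proof.
move=> le_fd; rewrite /lext; apply: big_fset_incl => // p _.
by move=> /mcoeff_outdom ->; rewrite scale0r.
Qed.

Lemma lext_linear (W : lmodType k) (h : tpath E -> W) : linear (lext h).
Proof.
move=> c f g.
pose d := (msupp (c *: f + g) `|` (msupp f `|` msupp g))%fset.
rewrite !(@lextEw _ h _ d) ?fsubsetUl //; last 2 first.
- by rewrite /d fsubsetU // fsubsetUr orbT.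
- by rewrite /d fsubsetU // fsubsetUl orbT.
rewrite scaler_sumr -big_split /=; apply: eq_bigr => p _.
by rewrite mcoeffD mcoeffZ scalerDl scalerA.
Qed.

HB.instance Definition _ (W : lmodType k) (h : tpath E -> W) :=
  GRing.isLinear.Build k palg W _ (lext h) (@lext_linear W h).

Lemma lext_basis (W : lmodType k) (h : tpath E -> W) (p : tpath E) :
  lext h (<< p >> : palg) = h p.
Proof.
rewrite (@lextEw _ h _ [fset p]%fset) ?msuppU_le //.
by rewrite big_seq_fset1 mcoeffUU scale1r.
Qed.

Lemma palg_sum (f : palg) : f = \sum_(p <- msupp f) f@_p *: (<< p >> : palg).
Proof.
rewrite {1}[f]monalgE; apply: eq_bigr => p _.
by apply/malgP => q; rewrite mcoeffZ !mcoeffU mulrnAr mulr1.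
Qed.

Lemma lext_ext (W : lmodType k) (u v : {linear palg -> W}) :
  (forall p : tpath E, u (<< p >> : palg) = v (<< p >> : palg)) -> u =1 v.
Proof.
move=> uv f; rewrite [f]palg_sum !linear_sum; apply: eq_bigr => p _.
by rewrite !linearZ uv.
Qed.

Lemma palg_mulEl f g : palg_mul f g = lext (fun q => lext (tmul q) g) f.
Proof.
apply: eq_bigr => q _; rewrite scaler_sumr; apply: eq_bigr => p _.
by rewrite scalerA.
Qed.

Lemma palg_mulEr f g : palg_mul f g = lext (fun p => lext (tmul^~ p) f) g.
Proof.
rewrite /palg_mul exchange_big /=; apply: eq_bigr => p _.
by rewrite scaler_sumr; apply: eq_bigr => q _; rewrite scalerA mulrC.
Qed.

Lemma palg_mul_linearl g : linear (palg_mul^~ g).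
Proof. by move=> c f f'; rewrite !palg_mulEl linearP. Qed.

Lemma palg_mul_linearr f : linear (palg_mul f).
Proof. by move=> c g g'; rewrite !palg_mulEr linearP. Qed.

HB.instance Definition _ f :=
  GRing.isLinear.Build k palg palg _ (palg_mul f) (palg_mul_linearr f).

Definition palg_mulr g f := palg_mul f g.
HB.instance Definition _ g :=
  GRing.isLinear.Build k palg palg _ (palg_mulr g) (palg_mul_linearl g).

Lemma palg_mulU (q p : tpath E) :
  palg_mul (<< q >> : palg) (<< p >> : palg) = tmul q p.
Proof. by rewrite palg_mulEl !lext_basis. Qed.

Lemma tmulE x y z (q : qpath E y z) (p : qpath E x y) :
  tmul (TPath q) (TPath p) = basis (pcat q p).
Proof.
by rewrite /tmul /=; case: eqP => // e; rewrite (eq_axiomK e).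
Qed.

Lemma tmul0 (q p : tpath E) : ttgt p <> tsrc q -> tmul q p = 0.
Proof. by rewrite /tmul; case: eqP. Qed.

Lemma tmulA (r q p : tpath E) :
  palg_mul (<< r >> : palg) (tmul q p) = palg_mul (tmul r q) (<< p >> : palg).
Proof.
have m0l g : palg_mul 0 g = 0 by exact: (linear0 (palg_mulr g)).
case: (ttgt p =P tsrc q) => [e|ne]; last first.
  rewrite (tmul0 ne) linear0; case: (ttgt q =P tsrc r) => [e'|ne'].
    case: q r ne e' => [x y q] [y' z r] /= ne e'; case: _ / e' r => r.
    by rewrite tmulE palg_mulU tmul0.
  by rewrite (tmul0 ne') m0l.
case: p q e => [x y p] [y' z q] /= e; case: _ / e q => q; rewrite tmulE.
case: (z =P tsrc r) => [e'|ne'].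
  case: r e' => [z' t r] /= e'; case: _ / e' r => r.
  by rewrite !tmulE !palg_mulU !tmulE pcatA.
by rewrite palg_mulU !tmul0 // m0l.
Qed.

Lemma palg_mulA : associative palg_mul.
Proof.
move=> h g f.
apply: (lext_ext (u := palg_mul h \o palg_mul g)
                 (v := palg_mul (palg_mul h g))) => p /=.
apply: (lext_ext (u := palg_mul h \o palg_mulr << p >>)
                 (v := palg_mulr << p >> \o palg_mul h)) => q /=.
apply: (lext_ext (u := palg_mulr (palg_mul << q >> << p >>))
                 (v := palg_mulr << p >> \o palg_mulr << q >>)) => r /=.
by rewrite /palg_mulr !palg_mulU tmulA.
Qed.

Lemma palg_mul1r : left_id palg_one palg_mul.
Proof.
move=> f; apply: (lext_ext (u := palg_mul palg_one) (v := idfun)) => -[x y p].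
rewrite -[LHS]/(palg_mulr << TPath p >> palg_one) /palg_one.
rewrite linear_sum (bigD1 y) //=.
rewrite /palg_mulr palg_mulU tmulE big1 ?addr0 // => z zy.
by rewrite palg_mulU tmul0 //=; apply/eqP; rewrite eq_sym.
Qed.

Lemma palg_mulr1 : right_id palg_one palg_mul.
Proof.
move=> f; apply: (lext_ext (u := palg_mulr palg_one) (v := idfun)) => -[x y p].
rewrite -[LHS]/(palg_mul << TPath p >> palg_one) /palg_one.
rewrite linear_sum (bigD1 x) //= palg_mulU.
rewrite tmulE pcatp0 big1 ?addr0 // => z zx.
by rewrite palg_mulU tmul0 //=; apply/eqP.
Qed.

Lemma palg_mulDl : left_distributive palg_mul +%R.
Proof. by move=> f g h; rewrite -[LHS]/(palg_mulr h (f + g)) linearD. Qed.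

Lemma palg_mulDr : right_distributive palg_mul +%R.
Proof. by move=> f g h; rewrite linearD. Qed.

HB.instance Definition _ := GRing.Zmodule_isPzRing.Build palg
  palg_mulA palg_mul1r palg_mulr1 palg_mulDl palg_mulDr.

Lemma palg_scaleAl c (f g : palg) : c *: (f * g) = (c *: f) * g.
Proof. by rewrite -[RHS]/(palg_mulr g (c *: f)) linearZ. Qed.

Lemma palg_scaleAr c (f g : palg) : c *: (f * g) = f * (c *: g).
Proof. by rewrite -[RHS]/(palg_mul f (c *: g)) linearZ. Qed.

Definition palg_map (c : k) : palg := c *: palg_one.

Lemma palg_map_zmod : zmod_morphism palg_map.
Proof. by move=> a b; rewrite /palg_map scalerBl. Qed.

Lemma palg_map_monoid : monoid_morphism palg_map.
Proof.
split=> [|a b]; first by rewrite /palg_map scale1r.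
by rewrite /palg_map -palg_scaleAl mul1r scalerA.
Qed.

HB.instance Definition _ :=
  GRing.isZmodMorphism.Build k palg palg_map palg_map_zmod.
HB.instance Definition _ :=
  GRing.isMonoidMorphism.Build k palg palg_map palg_map_monoid.

Lemma palg_central c x : palg_map c * x = x * palg_map c.
Proof. by rewrite /palg_map -palg_scaleAl -palg_scaleAr mul1r mulr1. Qed.

Definition path_algebra : algebra k := Algebra palg_central.

End PathAlgebra.

Section Representations.
Variable F : fieldType.

Section Fixed.
Variables (V : Type) (E : V -> V -> Type).

Record rep := Rep {
  rsp : V -> vectType F;
  rmp : forall x y, E x y -> 'Hom(rsp x, rsp y) }.

Fixpoint ract (M : rep) x y (p : qpath E x y) : 'Hom(rsp M x, rsp M y) :=
  match p with
  | pnil => \1%VF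
  | pcons _ _ a p' => (rmp M a \o ract M p')%VF
  end.

Record rep_hom (M N : rep) := RepHom {
  rh :> forall x, 'Hom(rsp M x, rsp N x);
  rhP : forall x y (a : E x y), (rh y \o rmp M a = rmp N a \o rh x)%VF }.

Lemma rep_hom_ext (M N : rep) (f g : rep_hom M N) :
  (forall x, f x = g x) -> f = g.
Proof.
case: f g => [f fP] [g gP] /= fg.
have {}fg : f = g by apply: functional_extensionality_dep.
by case: _ / fg gP => gP; rewrite (Prop_irrelevance fP gP).
Qed.

Lemma ract_nat (M N : rep) (f : rep_hom M N) x y (p : qpath E x y) :
  (f y \o ract M p = ract N p \o f x)%VF.
Proof.
elim: p => [|u v a p IH] /=; first by rewrite comp_lfun1l comp_lfun1r.
by rewrite comp_lfunA rhP -comp_lfunA IH comp_lfunA.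
Qed.

Program Definition rep_id M : rep_hom M M := @RepHom M M (fun=> \1%VF) _.
Next Obligation. by move=> M x y a; rewrite comp_lfun1l comp_lfun1r. Qed.

Program Definition rep_cmp M N P (g : rep_hom N P) (f : rep_hom M N) :
  rep_hom M P := @RepHom M P (fun x => g x \o f x)%VF _.
Next Obligation.
by move=> M N P g f x y a /=; rewrite -comp_lfunA rhP comp_lfunA rhP comp_lfunA.
Qed.

Program Definition Mod : category := @Category rep rep_hom rep_id rep_cmp _ _ _.
Next Obligation.
by move=> X Y f; apply: rep_hom_ext => x /=; rewrite comp_lfun1l.
Qed.
Next Obligation.
by move=> X Y f; apply: rep_hom_ext => x /=; rewrite comp_lfun1r.
Qed.
Next Obligation.
by move=> X Y Z T h g f; apply: rep_hom_ext => x /=; rewrite comp_lfunA.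
Qed.

End Fixed.

(* Restriction of representations of [E] along an assignment of a vertex of
   [E] to each vertex of [E'] and of a path of [E] to each arrow of [E']. *)
Section Pullback.
Variables (V V' : Type) (E : V -> V -> Type) (E' : V' -> V' -> Type).
Variables (phi : V' -> V).
Variable phiE : forall x y, E' x y -> qpath E (phi x) (phi y).

Definition pull_obj (M : rep E) : rep E' :=
  @Rep _ E' (fun x => rsp M (phi x)) (fun x y a => ract M (phiE a)).

Program Definition pull_map (M N : rep E) (f : rep_hom M N) :
  rep_hom (pull_obj M) (pull_obj N) := @RepHom _ _ _ _ (fun x => f (phi x)) _.
Next Obligation. by move=> M N f x y a /=; apply: ract_nat. Qed.

Program Definition pullback : functor (Mod E) (Mod E') :=
  @Functor (Mod E) (Mod E') pull_obj pull_map _ _.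
Next Obligation. by move=> X; apply: rep_hom_ext. Qed.
Next Obligation. by move=> X Y Z g f; apply: rep_hom_ext. Qed.

End Pullback.
End Representations.

Local Open Scope nat_scope.

(* The integers [a, ..., b], so that vertices are numbered as usual from 1. *)
Record ivl (a b : nat) := Ivl { num :> nat; numP : (a <= num <= b) }.
Arguments ivl (a b)%_nat_scope.

Section Ivl.
Variables a b : nat.

HB.instance Definition _ := [isSub for @num a b].
HB.instance Definition _ := [Countable of ivl a b by <:].

Definition ivl_ord (x : ivl a b) : 'I_b.+1 := inord x.
Definition ord_ivl (i : 'I_b.+1) : option (ivl a b) := insub (val i).

Lemma ivl_ordK : pcancel ivl_ord ord_ivl.
Proof.
move=> x; rewrite /ord_ivl /ivl_ord /= inordK; first exact: valK.
by case/andP: (numP x).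
Qed.

HB.instance Definition _ : isFinite (ivl a b) := PCanIsFinite ivl_ordK.

End Ivl.

(* [relA] and [relD] restricted to [{1, ..., m}] are the quivers [A_m] and
   [D_m]. *)
Definition relA : rel nat := fun x y => y == x.+1.
Definition relD : rel nat := fun x y =>
  ((x < 3) && (y == 3) || (3 <= x) && (y == x.+1)).

Definition thin (r : rel nat) (m : nat) (x y : ivl 1 m) : Type := r x y.

Definition quiverA (m : nat) := @thin relA m.
Definition quiverD (m : nat) := @thin relD m.

Definition or_case (b c : bool) : b || c -> {b} + {c} :=
  match b with
  | true => fun h => left h
  | false => fun h => right h
  end.

(* [bump i] is the increasing bijection of the vertices onto those other than
   [i]; after contraction there is an arrow for each arrow [x -> y] and each
   pair of arrows [x -> i -> y] of the original quiver, [x] and [y] being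
   different from [i]. *)
Definition contracted (r : rel nat) (i : nat) : rel nat := fun x y =>
  r (bump i x) (bump i y) || r (bump i x) i && r i (bump i y).

Lemma contractedA i x y : (0 < i) -> (0 < x) -> (0 < y) ->
  contracted relA i x y = relA x y.
Proof.
by rewrite /contracted /relA /bump => *; apply/idP/idP; lia.
Qed.

Lemma contractedD i x y : (3 <= i) -> (0 < x) -> (0 < y) ->
  contracted relD i x y = relD x y.
Proof.
by rewrite /contracted /relD /bump => *; apply/idP/idP; lia.
Qed.

Lemma contractedDA i x y : (1 <= i <= 2) -> (0 < x) -> (0 < y) ->
  contracted relD i x y = relA x y.
Proof.
by rewrite /contracted /relD /relA /bump => *; apply/idP/idP; lia.
Qed.

Section Contraction.
Variables (r r' : rel nat) (m p i : nat).
Hypothesis mp : m = p.+1.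
Hypothesis im : (1 <= i <= m).
Hypothesis rr' : forall x y, (0 < x) -> (0 < y) ->
  contracted r i x y = r' x y.

Lemma contr_vertP (x : ivl 1 p) : (1 <= bump i x <= m).
Proof. by move: (numP x) mp; rewrite /bump; lia. Qed.

Definition contr_vert (x : ivl 1 p) : ivl 1 m := Ivl (contr_vertP x).

Lemma contr_arrowP (x y : ivl 1 p) : r' x y -> contracted r i x y.
Proof. by rewrite rr' //; [case/andP: (numP x)|case/andP: (numP y)]. Qed.

Definition contr_arrow (x y : ivl 1 p) (a : thin r' x y) :
    qpath (@thin r m) (contr_vert x) (contr_vert y) :=
  match or_case (contr_arrowP a) with
  | left b => parrow (b : @thin r m (contr_vert x) (contr_vert y))
  | right b =>
      let: conj b1 b2 := andP b in
      pcat (parrow (b2 : @thin r m (Ivl im) (contr_vert y)))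
           (parrow (b1 : @thin r m (contr_vert x) (Ivl im)))
  end.

End Contraction.

(* [unbump i] sends the new vertex [i] and its successor [i.+1] to the former
   vertex [i]; an arrow is sent to a trivial path or to an arrow. *)
Definition inserted (r : rel nat) (i : nat) : rel nat := fun x y =>
  (unbump i x == unbump i y) || r (unbump i x) (unbump i y).

Lemma insertedA i x y : (0 < i) -> (0 < x) -> relA x y ->
  inserted relA i x y.
Proof. by rewrite /inserted /relA /unbump; lia. Qed.

Lemma insertedD i x y : (3 <= i) -> (0 < x) -> relD x y ->
  inserted relD i x y.
Proof. by rewrite /inserted /relD /unbump; lia. Qed.

Section Insertion.
Variables (r r' : rel nat) (p m i : nat).
Hypothesis mp : m = p.+1.
Hypothesis ip : (1 <= i <= p).
Hypothesis rr' : forall x y, (0 < x) -> r' x y -> inserted r i x y.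

Lemma ins_vertP (x : ivl 1 m) : (1 <= unbump i x <= p).
Proof. by move: (numP x) ip mp; rewrite /unbump; lia. Qed.

Definition ins_vert (x : ivl 1 m) : ivl 1 p := Ivl (ins_vertP x).

Lemma ins_arrowP (x y : ivl 1 m) : r' x y ->
  (ins_vert x == ins_vert y) || r (ins_vert x) (ins_vert y).
Proof. by apply: rr'; case/andP: (numP x). Qed.

Definition ins_arrow (x y : ivl 1 m) (a : thin r' x y) :
    qpath (@thin r p) (ins_vert x) (ins_vert y) :=
  match or_case (ins_arrowP a) with
  | left e => ecast v (qpath _ _ v) (eqP e) pnil
  | right b => parrow (b : @thin r p (ins_vert x) (ins_vert y))
  end.

End Insertion.

Definition swap12 (x : nat) : nat :=
  if x == 1 then 2 else if x == 2 then 1 else x.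

Section Swap.
Variable m : nat.
Hypothesis m3 : (3 <= m).

Lemma swap_vertP (x : ivl 1 m) : (1 <= swap12 x <= m).
Proof. by move: (numP x) m3; rewrite /swap12; do ![case: eqP => ?]; lia. Qed.

Definition swap_vert (x : ivl 1 m) : ivl 1 m := Ivl (swap_vertP x).

Lemma swap_arrowP (x y : ivl 1 m) : relD x y ->
  relD (swap_vert x) (swap_vert y).
Proof.
case: x y => x xP [y yP] /=; rewrite /relD /swap12.
by case: x xP => [|[|[|x]]] // xP; case: y yP => [|[|[|y]]] //; lia.
Qed.

Definition swap_arrow (x y : ivl 1 m) (a : thin relD x y) :
    qpath (@thin relD m) (swap_vert x) (swap_vert y) :=
  parrow (swap_arrowP a : @thin relD m (swap_vert x) (swap_vert y)).

End Swap.

Section Functors.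
Variable F : fieldType.

Definition ModA m : category := Mod F (@quiverA m).
Definition ModD m : category := Mod F (@quiverD m).

Section Index.
Variables (m p i : nat).
Hypothesis mp : m == p.+1.

Program Definition piA (im : (1 <= i < m)) : functor (ModA m) (ModA p) :=
  pullback F (@contr_arrow relA relA m p i (eqP mp) _ _).
Next Obligation. by lia. Qed.
Next Obligation. by move=> im x y; apply: contractedA; lia. Qed.

Program Definition piD (im : (3 <= i < m)) : functor (ModD m) (ModD p) :=
  pullback F (@contr_arrow relD relD m p i (eqP mp) _ _).
Next Obligation. by lia. Qed.
Next Obligation. by move=> im x y; apply: contractedD; lia. Qed.

Program Definition piDA (im : (1 <= i <= 2)) (m3 : (3 <= m)) :
    functor (ModD m) (ModA p) :=
  pullback F (@contr_arrow relD relA m p i (eqP mp) _ _).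
Next Obligation. by lia. Qed.
Next Obligation. by move=> im m3 x y; apply: contractedDA. Qed.

Program Definition iotaA (im : (1 <= i <= m - 2)) :
    functor (ModA p) (ModA m) :=
  pullback F (@ins_arrow relA relA p m i (eqP mp) _ _).
Next Obligation. by lia. Qed.
Next Obligation. by move=> im x y; apply: insertedA; lia. Qed.

Program Definition iotaD (im : (3 <= i <= m - 2)) :
    functor (ModD p) (ModD m) :=
  pullback F (@ins_arrow relD relD p m i (eqP mp) _ _).
Next Obligation. by lia. Qed.
Next Obligation. by move=> im x y; apply: insertedD; lia. Qed.

End Index.

Definition swapD m (m3 : (3 <= m)) : functor (ModD m) (ModD m) :=
  pullback F (swap_arrow m3).

End Functors.

Section Configuration.
Variables (k : comNzRingType) (F : fieldType) (n : nat).

(* [inl m] is [D_m] and [inr m] is [A_m]. *)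
Definition gam_vert : finType := (ivl 3 n.+1 + ivl 2 n)%type.

Inductive gam_arrow : gam_vert -> gam_vert -> Type :=
| gam_t (m : ivl 3 n.+1) : gam_arrow (inl m) (inl m)
| gam_piD (m p : ivl 3 n.+1) (i : nat) of m == p.+1 :> nat & (3 <= i < m) :
    gam_arrow (inl m) (inl p)
| gam_iotaD (m p : ivl 3 n.+1) (i : nat)
    of m == p.+1 :> nat & (3 <= i <= m - 2) :
    gam_arrow (inl p) (inl m)
| gam_piDA (m : ivl 3 n.+1) (p : ivl 2 n) (i : nat)
    of m == p.+1 :> nat & (1 <= i <= 2) :
    gam_arrow (inl m) (inr p)
| gam_piA (m p : ivl 2 n) (i : nat) of m == p.+1 :> nat & (1 <= i < m) :
    gam_arrow (inr m) (inr p)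
| gam_iotaA (m p : ivl 2 n) (i : nat)
    of m == p.+1 :> nat & (1 <= i <= m - 2) :
    gam_arrow (inr p) (inr m).

Definition gam_cat (v : gam_vert) : category :=
  match v with
  | inl m => ModD F m
  | inr m => ModA F m
  end.

Lemma ivl_lb a b (x : ivl a b) : (a <= x).
Proof. by case/andP: (numP x). Qed.

Definition gam_label (v w : gam_vert) (a : gam_arrow v w) :
    functor (gam_cat v) (gam_cat w) :=
  match a in gam_arrow v w return functor (gam_cat v) (gam_cat w) with
  | gam_t m => swapD F (ivl_lb m)
  | gam_piD m p i mp im => piD F mp im
  | gam_iotaD m p i mp im => iotaD F mp im
  | gam_piDA m p i mp im => piDA F mp im (ivl_lb m)
  | gam_piA m p i mp im => piA F mp im
  | gam_iotaA m p i mp im => iotaA F mp im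
  end.

Fixpoint gam_eval (v w : gam_vert) (p : qpath gam_arrow v w) :
    functor (gam_cat v) (gam_cat w) :=
  match p with
  | pnil => fid (gam_cat v)
  | pcons _ _ a p' => fcomp (gam_label a) (gam_eval p')
  end.

Inductive gam_relation : path_algebra k gam_arrow -> Prop :=
| GamRelation v w (p1 p2 : qpath gam_arrow v w) :
    nat_iso (gam_eval p1) (gam_eval p2) ->
    gam_relation (basis k p1 - basis k p2)%R.

Definition kD1 : algebra k := quotient_algebra gam_relation.

End Configuration.

Local Open Scope ring_scope.

Section BoundQuiver.
Variables (k : comNzRingType) (n : nat).

(* [inl j] is the vertex [j] and [inr j] is the vertex [j']. *)
Definition bq_vert : finType := (ivl 2 n + ivl 1 n.-1)%type.

Inductive bq_arrow : bq_vert -> bq_vert -> Type :=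
| bq_d (j i : ivl 2 n) of j == i.+1 :> nat : bq_arrow (inl j) (inl i)
| bq_a (j i : ivl 1 n.-1) of j == i.+1 :> nat : bq_arrow (inr j) (inr i)
| bq_c (j : ivl 2 n) (i : ivl 1 n.-1) of j == i.+1 :> nat :
    bq_arrow (inl j) (inr i)
| bq_t (j : ivl 2 n) : bq_arrow (inl j) (inl j).

Local Notation Q := (path_algebra k bq_arrow).
Local Notation "[ a ]" := (basis k (parrow a) : Q).

Definition bq_e (j : ivl 2 n) : Q := basis k (@pnil _ bq_arrow (inl j)).

Inductive bq_relation : Q -> Prop :=
| bq_tt j : bq_relation ([bq_t j] * [bq_t j] - bq_e j)
| bq_tdt (j i : ivl 2 n) (ji : j == i.+1 :> nat) :
    bq_relation ([bq_t i] * [bq_d ji] * [bq_t j] - [bq_d ji])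
| bq_cda (j i : ivl 2 n) (j' i' : ivl 1 n.-1) (ji : j == i.+1 :> nat)
    (ii' : i == i'.+1 :> nat) (jj' : j == j'.+1 :> nat)
    (ji' : j' == i'.+1 :> nat) :
    bq_relation (([bq_c ii'] - [bq_c ii'] * [bq_t i]) * [bq_d ji]
                 - [bq_a ji'] * ([bq_c jj'] - [bq_c jj'] * [bq_t j]))
| bq_dd (l j i : ivl 2 n) (lj : l == j.+1 :> nat) (ji : j == i.+1 :> nat) :
    bq_relation ([bq_d ji] * [bq_d lj])
| bq_aa (l j i : ivl 1 n.-1) (lj : l == j.+1 :> nat) (ji : j == i.+1 :> nat) :
    bq_relation ([bq_a ji] * [bq_a lj]).

Definition kBQ : algebra k := quotient_algebra bq_relation.

End BoundQuiver.

(* Main.v *)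
(* A path of the configuration acts as restriction along a map of vertices, and two
   paths are naturally isomorphic exactly when these maps agree (test them on simple
   representations). The [A_m] thus form a truncated opposite simplex category, and
   the [D_m] a truncated augmented one with an extra involution [t]. As in the
   Dold-Kan correspondence, let [e] be the sum of the projectors onto normalized
   chains. Since each degeneracy factors through a smaller vertex, [e] is full, so the
   algebra [A] of the configuration is Morita equivalent to [e A e].

   The morphism [psi] from the bound quiver algebra to [e A e] sends [d] to [-pi_3 e],
   [a] to [pi_1 e], [t] to [t e], and [c] to [e pi_2 e], which is
   [(1 - iota_1 pi_2) pi_2 e]. Its inverse is induced by [theta], which sends a path to
   zero unless its vertex map is injective and hits every [i] above the first vertex of
   the chain (1 in [A_m], 3 in [D_m]); there are eleven forms of such maps. *)
Require Import Defs.
From HB Require Import structures.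
From mathcomp Require Import all_boot all_algebra.
From mathcomp Require Import boolp.
From mathcomp.multinomials Require Import monalg.
From mathcomp Require Import zify.

Set Implicit Arguments.
Unset Strict Implicit.
Unset Printing Implicit Defensive.

Import GRing.Theory.
Local Open Scope ring_scope.

(** * Morita equivalence with a full corner *)

(** The map [theta] is not multiplicative: it sends pi_1 on A_m to a and pi_2 to c, but pi_1 pi_2 to
    ac - cd. That [psi] is bijective onto e A e therefore comes from three facts: [psi (theta x)] is
    e x e, [theta] ignores e on either side, and [theta] is onto. If b = [theta x], then
    [theta (psi b)] = [theta] (e x e) = b. Linear independence is never checked. The obstacle is the
    passage from D to A. Normalization involves every interior i > 1 on A_m but only i > 3 on D_m,
    so pi_2 fails to preserve normalized elements at the index 2; this forces the factor 1 - iota_1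
    pi_2 in c, and makes ac differ from pi_1 pi_2. Given td = dt, the relation between a, c and d
    says that ac - cd is fixed by t on the right. Its image is pi_1 pi_2 e, and after both 1 and 2
    are deleted their exchange is invisible. The relations dd = 0 and aa = 0 hold because two
    contractions at the start of the chain miss a vertex that a normal map must hit. *)

Section CornerMorita.
Variables (k : comPzRingType) (A B : algebra k).
Variables (psi : {additive B -> A}) (theta : A -> B) (s : seq (A * A)).
Hypothesis psiM : {morph psi : x y / x * y}.
Hypothesis psiZ : forall c b, psi (alg_map B c * b) = alg_map A c * psi b.
Hypothesis thetaK : forall x, psi (theta x) = psi 1 * x * psi 1.
Hypothesis psiK : cancel psi theta.
Hypothesis full : 1 = \sum_(p <- s) p.1 * psi 1 * p.2.

Let psi1M b : psi 1 * psi b = psi b. Proof. by rewrite -psiM mul1r. Qed.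
Let psiM1 b : psi b * psi 1 = psi b. Proof. by rewrite -psiM mulr1. Qed.

Section CornerModule.
Variable M : lmodType A.

(** The summand e M for the idempotent e = [psi 1]. As [psi] does not preserve the unit, only this
    summand is a unital module over [B]. *)
Definition corner_pred : {pred M} := fun m => psi 1 *: m == m.

Fact corner_zmod : zmod_closed corner_pred.
Proof.
split=> [|x y /eqP ex /eqP ey]; rewrite unfold_in ?scaler0 //.
by rewrite scalerBr ex ey.
Qed.

HB.instance Definition _ := GRing.isZmodClosed.Build M corner_pred corner_zmod.

Record corner := Corner { cval : M; cvalP : cval \in corner_pred }.
HB.instance Definition _ := [isSub for cval].
HB.instance Definition _ := [Choice of corner by <:].
HB.instance Definition _ := [SubChoice_isSubZmodule of corner by <:].

Lemma cvalE (x : corner) : psi 1 *: cval x = cval x.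
Proof. by apply/eqP; case: x. Qed.

Fact corner_scaleP b (x : corner) : psi b *: cval x \in corner_pred.
Proof. by rewrite unfold_in scalerA psi1M. Qed.

Definition corner_scale b x : corner := Corner (corner_scaleP b x).

Fact corner_scaleA a b v :
  corner_scale a (corner_scale b v) = corner_scale (a * b) v.
Proof. by apply: val_inj; rewrite /= scalerA psiM. Qed.
Fact corner_scale1 : left_id 1 corner_scale.
Proof. by move=> v; apply: val_inj; rewrite /= cvalE. Qed.
Fact corner_scaleDr : right_distributive corner_scale +%R.
Proof. by move=> b x y; apply: val_inj; rewrite /= scalerDr. Qed.
Fact corner_scaleDl v : {morph corner_scale^~ v : a b / a + b}.
Proof. by move=> a b; apply: val_inj; rewrite /= raddfD scalerDl. Qed.

HB.instance Definition _ := GRing.Zmodule_isLmodule.Build B corner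
  corner_scaleA corner_scale1 corner_scaleDr corner_scaleDl.

Lemma cvalZ b (x : corner) : cval (b *: x) = psi b *: cval x.
Proof. by []. Qed.

Lemma cvalD (x y : corner) : cval (x + y) = cval x + cval y.
Proof. by []. Qed.

End CornerModule.

Section CornerMap.
Variables (M N : lmodType A) (f : {linear M -> N}).

Fact corner_mapP (x : corner M) : f (cval x) \in @corner_pred N.
Proof. by rewrite unfold_in -linearZ /= cvalE. Qed.

Definition corner_map x : corner N := Corner (corner_mapP x).

Fact corner_map_linear : linear corner_map.
Proof. by move=> b x y; apply: val_inj; rewrite /= linearD linearZ. Qed.

HB.instance Definition _ := GRing.isLinear.Build B (corner M) (corner N) _
  corner_map corner_map_linear.
End CornerMap.

Definition corner_functor : functor (lmod_cat A) (lmod_cat B).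
Proof.
apply: (@Functor (lmod_cat A) (lmod_cat B) (fun M => corner M : lmodType B)
  (fun M N f => corner_map f : {linear corner M -> corner N})).
- by move=> M; apply: linear_ext => x; apply: val_inj.
- by move=> M N P g f; apply: linear_ext => x; apply: val_inj.
Defined.

Lemma corner_klinear : klinear corner_functor.
Proof.
move=> M N c f g h hE y; apply: val_inj; rewrite /= hE; congr (_ + _).
have {1}-> : f (cval y) = psi 1 *: f (cval y) by rewrite -linearZ /= cvalE.
by rewrite scalerA -psiZ mulr1.
Qed.

Section CoinducedModule.
Variable N : lmodType B.

(* These [phi] are the [B]-linear maps from [psi 1 * A] to [N]: the condition for
   [b = 1] says that [phi x] only depends on [psi 1 * x]. *)
Definition coind_pred (phi : A -> N) : Prop :=
  {morph phi : x y / x + y} /\ forall b x, phi (psi b * x) = b *: phi x.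

(** Coinduction is the right adjoint of the corner functor, and its elements are plain functions on
    [A]. *)
Record coind := Coind { cfun :> A -> N; cfunP : `[< coind_pred cfun >] }.
HB.instance Definition _ := [isSub for cfun].
HB.instance Definition _ := gen_eqMixin coind.
HB.instance Definition _ := gen_choiceMixin coind.

Lemma coindD (phi : coind) x y : phi (x + y) = phi x + phi y.
Proof. by case: phi => phi /= /asboolP[]. Qed.
Lemma coindM (phi : coind) b x : phi (psi b * x) = b *: phi x.
Proof. by case: phi => phi /= /asboolP[]. Qed.
Lemma coind1M (phi : coind) x : phi (psi 1 * x) = phi x.
Proof. by rewrite coindM scale1r. Qed.
Lemma coind0 (phi : coind) : phi 0 = 0.
Proof. by apply: (addIr (phi 0)); rewrite -coindD !add0r. Qed.
Lemma coind_sum (phi : coind) I (r : seq I) (F : I -> A) :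
  phi (\sum_(i <- r) F i) = \sum_(i <- r) phi (F i).
Proof. exact: (big_morph _ (coindD phi) (coind0 phi)). Qed.
Lemma coind_ext (phi phi' : coind) : phi =1 phi' -> phi = phi'.
Proof. by move=> /funext e; apply: val_inj. Qed.

Fact coind_zeroP : `[< coind_pred (fun=> 0) >].
Proof. by apply/asboolP; split=> [x y|b x] /=; rewrite ?addr0 ?scaler0. Qed.
Fact coind_oppP (phi : coind) : `[< coind_pred (fun x => - phi x) >].
Proof.
by apply/asboolP; split=> [x y|b x] /=; rewrite ?coindD ?coindM ?opprD ?scalerN.
Qed.
Fact coind_addP (phi phi' : coind) : `[< coind_pred (fun x => phi x + phi' x) >].
Proof.
apply/asboolP; split=> [x y|b x] /=; first by rewrite !coindD addrACA.
by rewrite !coindM scalerDr.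
Qed.
Fact coind_scaleP (a : A) (phi : coind) : `[< coind_pred (fun x => phi (x * a)) >].
Proof.
by apply/asboolP; split=> [x y|b x] /=; rewrite ?mulrDl -?mulrA ?coindD ?coindM.
Qed.

Definition coind_zero := Coind coind_zeroP.
Definition coind_opp phi := Coind (coind_oppP phi).
Definition coind_add phi phi' := Coind (coind_addP phi phi').
Definition coind_scale a phi := Coind (coind_scaleP a phi).

Fact coind_addA : associative coind_add.
Proof. by move=> f g h; apply: coind_ext => x; apply: addrA. Qed.
Fact coind_addC : commutative coind_add.
Proof. by move=> f g; apply: coind_ext => x; apply: addrC. Qed.
Fact coind_add0 : left_id coind_zero coind_add.
Proof. by move=> f; apply: coind_ext => x; apply: add0r. Qed.
Fact coind_addN : left_inverse coind_zero coind_opp coind_add.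
Proof. by move=> f; apply: coind_ext => x; apply: addNr. Qed.

HB.instance Definition _ := GRing.isZmodule.Build coind
  coind_addA coind_addC coind_add0 coind_addN.

Fact coind_scaleA a b phi :
  coind_scale a (coind_scale b phi) = coind_scale (a * b) phi.
Proof. by apply: coind_ext => x; rewrite /= mulrA. Qed.
Fact coind_scale1 : left_id 1 coind_scale.
Proof. by move=> phi; apply: coind_ext => x; rewrite /= mulr1. Qed.
Fact coind_scaleDr : right_distributive coind_scale +%R.
Proof. by move=> a f g; apply: coind_ext. Qed.
Fact coind_scaleDl phi : {morph coind_scale^~ phi : a b / a + b}.
Proof. by move=> a b; apply: coind_ext => x; rewrite /= mulrDr coindD. Qed.

HB.instance Definition _ := GRing.Zmodule_isLmodule.Build A coind
  coind_scaleA coind_scale1 coind_scaleDr coind_scaleDl.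

Lemma coind_scaleE (a : A) (phi : coind) x : (a *: phi) x = phi (x * a).
Proof. by []. Qed.
Lemma coind_addE (phi phi' : coind) x : (phi + phi') x = phi x + phi' x.
Proof. by []. Qed.

End CoinducedModule.

Section CoinducedMap.
Variables (M N : lmodType B) (f : {linear M -> N}).

Fact coind_mapP (phi : coind M) : `[< coind_pred (fun x => f (phi x)) >].
Proof.
by apply/asboolP; split=> [x y|b x] /=; rewrite ?coindD ?coindM ?linearD ?linearZ.
Qed.

Definition coind_map phi : coind N := Coind (coind_mapP phi).

Fact coind_map_linear : linear coind_map.
Proof. by move=> a x y; apply: coind_ext => z; rewrite /= linearD. Qed.

HB.instance Definition _ := GRing.isLinear.Build A (coind M) (coind N) _
  coind_map coind_map_linear.
End CoinducedMap.

Definition coind_functor : functor (lmod_cat B) (lmod_cat A).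
Proof.
apply: (@Functor (lmod_cat B) (lmod_cat A) (fun M => coind M : lmodType A)
  (fun M N f => coind_map f : {linear coind M -> coind N})).
- by move=> M; apply: linear_ext => x; apply: coind_ext.
- by move=> M N P g f; apply: linear_ext => x; apply: coind_ext.
Defined.

Lemma coind_klinear : klinear coind_functor.
Proof.
move=> M N c f g h hE y; apply: coind_ext => x; rewrite /= hE; congr (_ + _).
rewrite -linearZ -coindM -[alg_map B c]mulr1 psiZ /=; congr (f _).
by rewrite alg_central -mulrA coind1M alg_central.
Qed.

Section Unit.
Variable M : lmodType A.

Fact unitP m x : (psi 1 * x) *: m \in @corner_pred M.
Proof. by rewrite unfold_in scalerA mulrA psi1M. Qed.

Fact unit_coindP m : `[< coind_pred (fun x => Corner (unitP m x)) >].
Proof.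
apply/asboolP; split=> [x y|b x]; apply: val_inj.
  by rewrite /= mulrDr scalerDl.
by rewrite /= scalerA !mulrA psi1M psiM1.
Qed.

Definition unit_inv (m : M) : coind (corner M) := Coind (unit_coindP m).

(** If [phi] is x |-> e x m, then writing 1 as a sum of terms a e b recovers m as the sum of the a
    phi(b). *)
Definition unit_map (phi : coind (corner M)) : M :=
  \sum_(p <- s) p.1 *: cval (phi p.2).

Lemma unit_mapK : cancel unit_inv unit_map.
Proof.
move=> m; rewrite /unit_map -[RHS]scale1r full scaler_suml.
by apply: eq_bigr => p _; rewrite /= scalerA mulrA.
Qed.

Lemma unit_invK : cancel unit_map unit_inv.
Proof.
move=> phi; apply: coind_ext => x; apply: val_inj => /=.
rewrite /unit_map scaler_sumr -[in RHS](mulr1 x) full mulr_sumr coind_sum.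
rewrite (big_morph (@cval M) (@cvalD M) (erefl : cval 0 = 0)); apply: eq_bigr => p _.
(* Up to e on the left, the argument is [psi (theta (x * p.1)) * p.2], so [B]-linearity takes the
   scalar out. *)
have -> : phi (x * (p.1 * psi 1 * p.2)) = theta (x * p.1) *: phi p.2.
  by rewrite -coindM thetaK -!mulrA coind1M.
by rewrite cvalZ thetaK -[in RHS]scalerA cvalE scalerA mulrA.
Qed.

Fact unit_inv_linear : linear unit_inv.
Proof.
move=> a m m'; apply: coind_ext => x; apply: val_inj => /=.
by rewrite scalerDr scalerA mulrA.
Qed.

HB.instance Definition _ := GRing.isLinear.Build A M (coind (corner M)) _
  unit_inv unit_inv_linear.

HB.instance Definition _ := GRing.isLinear.Build A (coind (corner M)) M _
  unit_map (can2_linear unit_mapK unit_invK).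

End Unit.

Section Counit.
Variable N : lmodType B.

(** Elements of this corner satisfy phi(x e) = phi(x), so they are determined on e A e, a copy of
    [B], and there by the value at 1. *)
Definition counit (phi : corner (coind N)) : N := cval phi 1.

Fact counit_linear : linear counit.
Proof.
move=> b phi phi'; rewrite /counit cvalD coind_addE cvalZ coind_scaleE.
by rewrite mul1r -[psi b]mulr1 coindM.
Qed.

HB.instance Definition _ := GRing.isLinear.Build B (corner (coind N)) N _
  counit counit_linear.

Let psi_inj : injective psi := can_inj psiK.

Fact counit_coindP (n : N) : `[< coind_pred (fun x => theta x *: n) >].
Proof.
apply/asboolP; split=> [x y|b x] /=.
  rewrite -scalerDl; congr (_ *: _); apply: psi_inj.
  by rewrite raddfD /= !thetaK mulrDr mulrDl.
rewrite scalerA; congr (_ *: _); apply: psi_inj.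
by rewrite psiM !thetaK !mulrA psi1M psiM1.
Qed.

Fact counit_cornerP n :
  (Coind (counit_coindP n) : coind N) \in @corner_pred (coind N).
Proof.
apply/eqP/coind_ext => x; rewrite coind_scaleE /=; congr (_ *: _).
by apply: psi_inj; rewrite !thetaK -!mulrA psi1M.
Qed.

Definition counit_inv n : corner (coind N) := Corner (counit_cornerP n).

Lemma counitK : cancel counit counit_inv.
Proof.
move=> phi; apply: val_inj; apply: coind_ext => x /=.
rewrite /counit -coindM thetaK mulr1 -mulrA coind1M -coind_scaleE.
by rewrite cvalE.
Qed.

Lemma counit_invK : cancel counit_inv counit.
Proof.
move=> n; rewrite /counit /= -[RHS]scale1r; congr (_ *: _); apply: psi_inj.
by rewrite thetaK mulr1 psi1M.
Qed.

HB.instance Definition _ := GRing.isLinear.Build B N (corner (coind N)) _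
  counit_inv (can2_linear counitK counit_invK).

End Counit.

Theorem corner_morita : morita_equivalent A B.
Proof.
exists corner_functor, coind_functor; split.
- exact: corner_klinear.
- exact: coind_klinear.
- exists (fun M : lmodType A => unit_map (M := M) : {linear coind (corner M) -> M}).
  split=> [M|M N f].
    exists (unit_inv (M := M) : {linear M -> coind (corner M)}).
    by split; apply: linear_ext => x /=; rewrite (unit_mapK, unit_invK).
  apply: linear_ext => phi /=; rewrite /unit_map linear_sum.
  by apply: eq_bigr => p _; rewrite linearZ.
- exists (fun N : lmodType B => counit (N := N) : {linear corner (coind N) -> N}).
  split=> [N|M N f].
    exists (counit_inv (N := N) : {linear N -> corner (coind N)}).
    by split; apply: linear_ext => x /=; rewrite (counitK, counit_invK).
  exact: linear_ext.
Qed.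

End CornerMorita.

(** * Maps out of bound path algebras *)

Section QuotientMaps.
Variable k : comNzRingType.

Section AlgebraModule.
Variable A : algebra k.

(** Restriction of scalars along [alg_map], so that [lext] can take values in [A]. *)
Definition alg_mod : Type := A.
HB.instance Definition _ := GRing.Zmodule.on alg_mod.

Fact alg_mod_scaleA a b (v : alg_mod) :
  alg_map A a * (alg_map A b * v) = alg_map A (a * b) * v.
Proof. by rewrite mulrA rmorphM. Qed.
Fact alg_mod_scale1 : left_id 1 (fun c (v : alg_mod) => alg_map A c * v).
Proof. by move=> v; rewrite rmorph1 mul1r. Qed.
Fact alg_mod_scaleDr :
  right_distributive (fun c (v : alg_mod) => alg_map A c * v) +%R.
Proof. by move=> c x y; rewrite mulrDr. Qed.
Fact alg_mod_scaleDl (v : alg_mod) :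
  {morph (fun c => alg_map A c * v : alg_mod) : a b / a + b}.
Proof. by move=> a b; rewrite rmorphD mulrDl. Qed.

HB.instance Definition _ := GRing.Zmodule_isLmodule.Build k alg_mod
  alg_mod_scaleA alg_mod_scale1 alg_mod_scaleDr alg_mod_scaleDl.

End AlgebraModule.

Section Descent.
Variables (A : algebra k) (R : A -> Prop) (W : zmodType) (f : {additive A -> W}).

(** Only additivity of [f] is assumed, since this serves both the multiplicative [psi] and
    [theta]. *)
Definition descent (x : quotient_algebra R) : W := f (repr (x : iquot R)).

Hypothesis fR : forall a b r, R r -> f (a * r * b) = 0.

Lemma descent_pi x : descent (iquot_pi R x) = f x.
Proof.
(* The largest two-sided ideal inside the kernel of [f]. *)
pose J (z : A) := forall a b, f (a * z * b) = 0.
have idJ : two_sided_ideal J.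
  split=> [a b|y z Jy Jz a b|c d y Jy a b]; first by rewrite mulr0 mul0r raddf0.
    by rewrite mulrDr mulrDl raddfD Jy Jz addr0.
  by rewrite (_ : a * _ * b = (a * c) * y * (d * b)) ?Jy // !mulrA.
have := iquot_repr (iquot_pi R x) => /iquot_piP/asboolP/(_ J idJ).
move=> /(_ (fun r Rr a b => fR a b Rr))/(_ 1 1).
by rewrite mul1r mulr1 raddfB => /eqP; rewrite subr_eq0 => /eqP.
Qed.

Fact descent_zmod : zmod_morphism descent.
Proof.
move=> x y; rewrite -[x]iquot_repr -[y]iquot_repr -(raddfB (iquot_pi R)).
by rewrite !descent_pi raddfB.
Qed.

End Descent.

Section PathAlgebraMaps.
Variables (V : finType) (E : V -> V -> Type).
Local Notation P := (path_algebra k E).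

Section LinearMaps.
Variables (B : algebra k) (h : tpath E -> B).

Definition path_lin : P -> B := lext (h : tpath E -> alg_mod B).

Fact path_lin_zmod : zmod_morphism path_lin.
Proof. by move=> x y; rewrite /path_lin linearB. Qed.
HB.instance Definition _ := GRing.isZmodMorphism.Build P B path_lin
  path_lin_zmod.

Lemma path_linZ c x : path_lin (alg_map P c * x) = alg_map B c * path_lin x.
Proof.
rewrite /path_lin /= /palg_map -palg_scaleAl.
by rewrite -[_ * x]/(palg_mul (palg_one k E) x) palg_mul1r linearZ.
Qed.

Lemma path_lin_basis x y (p : qpath E x y) : path_lin (basis k p) = h (TPath p).
Proof. exact: (@lext_basis k V E (alg_mod B) h (TPath p)). Qed.

End LinearMaps.

Lemma basis_cat x y z (q : qpath E y z) (p : qpath E x y) :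
  basis k q * basis k p = basis k (pcat q p) :> P.
Proof. by rewrite -[LHS]/(palg_mul _ _) palg_mulU tmulE. Qed.

Lemma basis_mul0 x y y' z (q : qpath E y' z) (p : qpath E x y) :
  y <> y' -> basis k q * basis k p = 0 :> P.
Proof. by move=> ne; rewrite -[LHS]/(palg_mul _ _) palg_mulU tmul0. Qed.

Lemma path_algebra1 : 1 = \sum_x basis k (@pnil V E x) :> P.
Proof. by []. Qed.

Lemma path_algebra_ind (S : P -> Prop) :
  S 0 -> (forall x y, S x -> S y -> S (x + y)) ->
  (forall c x, S x -> S (alg_map P c * x)) ->
  (forall x y (p : qpath E x y), S (basis k p)) -> forall x, S x.
Proof.
move=> S0 SD SZ Sp f; rewrite [f]palg_sum.
apply: big_ind => // -[x y p] _; have := SZ (mcoeff (TPath p) f) _ (Sp _ _ p).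
rewrite /= /palg_map -palg_scaleAl.
by rewrite -[_ * basis _ _]/(palg_mul (palg_one k E) _) palg_mul1r.
Qed.

Section Hom.
Variables (A : algebra k) (eps : V -> A) (alpha : forall x y, E x y -> A).
Hypothesis epsM : forall x y, eps x * eps y = if x == y then eps x else 0.
Hypothesis alphaE : forall x y (a : E x y), eps y * alpha a * eps x = alpha a.

Fixpoint path_val x y (p : qpath E x y) : A :=
  match p with
  | pnil => eps x
  | pcons _ _ a p' => alpha a * path_val p'
  end.

Let eps_id x : eps x * eps x = eps x. Proof. by rewrite epsM eqxx. Qed.

Lemma path_valE x y (p : qpath E x y) : eps y * path_val p * eps x = path_val p.
Proof.
elim: p => [|u v a p IH] /=; first by rewrite !eps_id.
have al : eps v * alpha a = alpha a.
  by rewrite -{1}(alphaE a) !mulrA eps_id alphaE.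
have ar : path_val p * eps x = path_val p by rewrite -{1}IH -mulrA eps_id IH.
by rewrite mulrA al -mulrA ar.
Qed.

Lemma path_val_epsl x y (p : qpath E x y) : eps y * path_val p = path_val p.
Proof. by rewrite -{1}path_valE !mulrA eps_id path_valE. Qed.

Lemma path_val_epsr x y (p : qpath E x y) : path_val p * eps x = path_val p.
Proof. by rewrite -{1}path_valE -mulrA eps_id path_valE. Qed.

Lemma path_val_cat x y z (q : qpath E y z) (p : qpath E x y) :
  path_val (pcat q p) = path_val q * path_val p.
Proof.
elim: q p => [|u v a q IH] p /=; first by rewrite path_val_epsl.
by rewrite IH mulrA.
Qed.

Local Notation psi0 := (path_lin (B := A) (fun p => path_val (tpth p))).

Lemma path_val_lin_basis x y (p : qpath E x y) : psi0 (basis k p) = path_val p.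
Proof. by rewrite path_lin_basis. Qed.

Lemma path_val_linM x y : psi0 (x * y) = psi0 x * psi0 y.
Proof.
have [sD sZ] : {morph psi0 : x y / x + y} /\
    forall c x, psi0 (alg_map P c * x) = alg_map A c * psi0 x.
  by split=> [u v|c u]; rewrite ?raddfD ?path_linZ.
have s0 : psi0 0 = 0 by rewrite raddf0.
elim/path_algebra_ind: x => [|x x' Sx Sx'|c x Sx|x1 y1 q].
- by rewrite mul0r s0 mul0r.
- by rewrite mulrDl !sD mulrDl Sx Sx'.
- by rewrite -mulrA !sZ Sx mulrA.
elim/path_algebra_ind: y => [|x x' Sx Sx'|c x Sx|x2 y2 p].
- by rewrite mulr0 s0 mulr0.
- by rewrite mulrDr !sD mulrDr Sx Sx'.
- by rewrite mulrA -alg_central -mulrA !sZ Sx !mulrA alg_central.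
case: (eqVneq y2 x1) => [e|/eqP ne].
  by case: _ / e q => q; rewrite basis_cat !path_val_lin_basis path_val_cat.
rewrite basis_mul0 // s0 !path_val_lin_basis -path_val_epsr -(path_val_epsl p).
by rewrite mulrA -(mulrA _ (eps x1)) epsM eq_sym (introF eqP ne) mulr0 mul0r.
Qed.

Variable R : P -> Prop.
Hypothesis psiR : forall r, R r -> psi0 r = 0.

(** The orthogonal idempotents [eps x] may have a sum different from 1, so this universal property
    yields morphisms into a corner. *)
Lemma quiver_hom : exists psi : {additive quotient_algebra R -> A},
  [/\ {morph psi : x y / x * y},
      forall c x, psi (alg_map (quotient_algebra R) c * x) = alg_map A c * psi x,
      psi 1 = \sum_x eps x &
      forall x y (p : qpath E x y),
        psi (iquot_pi R (basis k p)) = path_val p].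
Proof.
pose f : {additive P -> A} := path_lin (fun p => path_val (tpth p)).
have fR a b r : R r -> f (a * r * b) = 0.
  by move=> /psiR r0; rewrite /f /= !path_val_linM r0 mulr0 mul0r.
have fpi := descent_pi fR.
pose m := GRing.isZmodMorphism.Build _ _ (descent f) (descent_zmod fR).
pose psi : {additive quotient_algebra R -> A} := HB.pack (descent f) m.
have psiE x : psi (iquot_pi R x) = psi0 x := fpi x.
exists psi; split=> [x y|c x||x y p].
- rewrite -[x]iquot_repr -[y]iquot_repr -(rmorphM (iquot_pi R)).
  by rewrite !psiE path_val_linM.
- rewrite -[x]iquot_repr -[_ * _]/(iquot_pi R (alg_map P c) * _).
  by rewrite -(rmorphM (iquot_pi R)) !psiE path_linZ.
- rewrite -(rmorph1 (iquot_pi R)) psiE path_algebra1 raddf_sum.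
  by apply: eq_bigr => x _; rewrite /= path_lin_basis.
- by rewrite psiE path_lin_basis.
Qed.

End Hom.
End PathAlgebraMaps.
End QuotientMaps.

(** * Natural isomorphism of restriction functors *)

Section NaturalIsomorphisms.

Lemma nat_iso_refl (C D : category) (G : functor C D) : nat_iso G G.
Proof.
exists (fun X => idm (G X)); split=> [X|X Y f]; last by rewrite cmp1m cmpm1.
by exists (idm (G X)); rewrite cmp1m.
Qed.

Lemma nat_iso_trans (C D : category) (G H K : functor C D) :
  nat_iso G H -> nat_iso H K -> nat_iso G K.
Proof.
move=> [a [ai an]] [b [bi bn]]; exists (fun X => cmp (b X) (a X)).
split=> [X|X Y f]; last by rewrite -cmpA an cmpA bn cmpA.
have [[a' [a1 a2]] [b' [b1 b2]]] := (ai X, bi X).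
exists (cmp a' b'); split.
  by rewrite -cmpA (cmpA b') b1 cmp1m.
by rewrite -cmpA (cmpA (a X)) a2 cmp1m.
Qed.

Lemma nat_iso_sym (C D : category) (G H : functor C D) :
  nat_iso G H -> nat_iso H G.
Proof.
move=> [a [ai an]]; pose b X := projT1 (cid (ai X)).
have bP X := projT2 (cid (ai X)); exists b; split=> [X|X Y f].
  by exists (a X); case: (bP X).
have [[_ b2] [b1 _]] := (bP X, bP Y).
by rewrite -[LHS]cmpm1 -b2 -cmpA (cmpA _ _ (b X)) -an !cmpA b1 cmp1m.
Qed.

Lemma nat_iso_comp (C D E : category) (G G' : functor C D) (H H' : functor D E) :
  nat_iso G G' -> nat_iso H H' -> nat_iso (fcomp H G) (fcomp H' G').
Proof.
move=> [a [ai an]] [b [bi bn]].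
exists (fun X => cmp (b (G' X)) (fmap H (a X))); split=> [X|X Y f].
  have [[a' [a1 a2]] [b' [b1 b2]]] := (ai X, bi (G' X)).
  exists (cmp (fmap H a') b'); split.
    by rewrite -cmpA (cmpA b') b1 cmp1m /= -fmapM a1 fmap1.
  by rewrite -cmpA (cmpA (fmap H (a X))) /= -fmapM a2 fmap1 cmp1m.
by rewrite /= -cmpA -fmapM an fmapM cmpA bn cmpA.
Qed.

End NaturalIsomorphisms.

Section Pullbacks.
Variable F : fieldType.

Section Compose.
Variables (V V' V'' : Type) (E : V -> V -> Type) (E' : V' -> V' -> Type).
Variables (E'' : V'' -> V'' -> Type) (phi : V' -> V) (psi : V'' -> V').
Variables (phiE : forall x y, E' x y -> qpath E (phi x) (phi y)).
Variables (psiE : forall x y, E'' x y -> qpath E' (psi x) (psi y)).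

Fixpoint path_subst x y (p : qpath E' x y) : qpath E (phi x) (phi y) :=
  match p with
  | pnil => pnil
  | pcons _ _ a p' => pcat (phiE a) (path_subst p')
  end.

Lemma ract_cat (M : rep F E) x y z (q : qpath E y z) (p : qpath E x y) :
  ract M (pcat q p) = (ract M q \o ract M p)%VF.
Proof.
by elim: q p => [|u v a q IH] p /=; rewrite ?comp_lfun1l // IH comp_lfunA.
Qed.

Lemma ract_subst (M : rep F E) x y (p : qpath E' x y) :
  ract (pull_obj phiE M) p = ract M (path_subst p).
Proof. by elim: p => //= u v a p ->; rewrite ract_cat. Qed.

Lemma pullback_comp : nat_iso (fcomp (pullback F psiE) (pullback F phiE))
  (pullback F (phi := phi \o psi) (fun x y a => path_subst (psiE a))).
Proof.
pose L M := (pullback F psiE (pullback F phiE M)).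
pose S M := pullback F (phi := phi \o psi)
  (fun x y a => path_subst (psiE a)) M.
have P M x y (a : E'' x y) : ((\1 : 'Hom(rsp (S M) y, rsp (S M) y))%VF
    \o rmp (L M) a = rmp (S M) a \o (\1 : 'Hom(rsp (S M) x, rsp (S M) x)))%VF.
  by rewrite /= comp_lfun1l comp_lfun1r ract_subst.
have P' M x y (a : E'' x y) : ((\1 : 'Hom(rsp (S M) y, rsp (S M) y))%VF
    \o rmp (S M) a = rmp (L M) a \o (\1 : 'Hom(rsp (S M) x, rsp (S M) x)))%VF.
  by rewrite /= comp_lfun1l comp_lfun1r ract_subst.
exists (fun M => @RepHom F _ _ (L M) (S M) (fun=> \1%VF) (P M)).
split=> [M|M N f]; last first.
  by apply: rep_hom_ext => x; rewrite /= comp_lfun1l comp_lfun1r.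
exists (@RepHom F _ _ (S M) (L M) (fun=> \1%VF) (P' M)).
by split; apply: rep_hom_ext => x; rewrite /= comp_lfun1l.
Qed.

End Compose.

Lemma pullback_id (V : Type) (E : V -> V -> Type) :
  nat_iso (fid (Mod F E)) (pullback F (phi := id) (@parrow V E)).
Proof.
pose S M := pullback F (phi := id) (@parrow V E) M.
have P M x y (a : E x y) : ((\1 : 'Hom(rsp M y, rsp M y))%VF
    \o rmp M a = rmp (S M) a \o (\1 : 'Hom(rsp M x, rsp M x)))%VF.
  by rewrite /= !comp_lfun1r comp_lfun1l.
have P' M x y (a : E x y) : ((\1 : 'Hom(rsp M y, rsp M y))%VF
    \o rmp (S M) a = rmp M a \o (\1 : 'Hom(rsp M x, rsp M x)))%VF.
  by rewrite /= !comp_lfun1r comp_lfun1l.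
exists (fun M => @RepHom F _ _ M (S M) (fun=> \1%VF) (P M)).
split=> [M|M N f]; last first.
  by apply: rep_hom_ext => x; rewrite /= comp_lfun1l comp_lfun1r.
exists (@RepHom F _ _ (S M) M (fun=> \1%VF) (P' M)).
by split; apply: rep_hom_ext => x; rewrite /= comp_lfun1l.
Qed.

Lemma pullback_eq (V V' : Type) (E : V -> V -> Type) (E' : V' -> V' -> Type)
    (phi psi : V' -> V) (phiE : forall x y, E' x y -> qpath E (phi x) (phi y))
    (psiE : forall x y, E' x y -> qpath E (psi x) (psi y)) :
  (forall x y (p q : qpath E x y), p = q) -> phi =1 psi ->
  nat_iso (pullback F phiE) (pullback F psiE).
Proof.
move=> uE /funext e; case: _ / e psiE => psiE.
suff -> : phiE = psiE by apply: nat_iso_refl.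
by do 3![apply: functional_extensionality_dep => ?]; apply: uE.
Qed.

Lemma pullback_inj (V V' : eqType) (E : V -> V -> Type) (E' : V' -> V' -> Type)
    (phi psi : V' -> V) (phiE : forall x y, E' x y -> qpath E (phi x) (phi y))
    (psiE : forall x y, E' x y -> qpath E (psi x) (psi y)) :
  nat_iso (pullback F phiE) (pullback F psiE) -> phi =1 psi.
Proof.
move=> [eta [/= etai _]] x; case: (eqVneq (psi x) (phi x)) => // ne; exfalso.
(* The simple representation at [phi x]: row vectors of length 1 there and of length 0 elsewhere. If
   [psi x] were another vertex, the identity of a line would factor through 0. *)
pose M := @Rep F V E (fun y => 'rV[F]_(y == phi x)) (fun _ _ _ => 0).
have [g [ge _]] := etai M.
have /lfunP /(_ (const_mx 1)) : (g x \o eta M x = \1)%VF.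
  exact: (congr1 (fun h => rh h x) ge).
rewrite lfunE /= lfunE /=; set v := eta M x _.
have -> : v = 0.
  apply/matrixP => i; rewrite [i]ord1; case=> j jlt.
  by exfalso; move: jlt; rewrite (negbTE ne).
have ne0 (b : bool) : b -> const_mx 1 = 0 :> 'rV[F]_b -> False.
  by case: b => // _ /matrixP /(_ 0 0) /eqP; rewrite !mxE oner_eq0.
by rewrite linear0 => /esym; apply: ne0.
Qed.

End Pullbacks.

(** * Uniqueness of paths in A_m and D_m *)

Section ThinPaths.
Variables (r : rel nat) (s rk : nat -> nat) (m : nat).
Hypothesis rs : forall x y, r x y -> y = s x.
Hypothesis rrk : forall x y, r x y -> rk y = (rk x).+1.
Local Notation E := (@thin r m).

Fixpoint path_len x y (p : qpath E x y) : nat :=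
  if p is pcons _ _ _ p' then (path_len p').+1 else 0.

Lemma thin_path_target x y (p : qpath E x y) : y = iter (path_len p) s x :> nat.
Proof. by elim: p => //= u v a p <-; apply: rs. Qed.

Lemma thin_path_rank x y (p : qpath E x y) : rk y = (rk x + path_len p)%N.
Proof. by elim: p => [|u v a p /= IH]; rewrite ?addn0 // (rrk a) IH addnS. Qed.

(** The ranks of the endpoints fix the length, and [s] fixes each vertex from the preceding one. *)
Lemma thin_path_uniq x y (p q : qpath E x y) : p = q.
Proof.
(* The transport lets the two paths be taken apart independently in the induction. *)
suff uq z (e : y = z) (q' : qpath E x z) : ecast z (qpath E x z) e p = q'.
  exact: (uq _ erefl).
elim: p z e q' => [|u v a p IH] z e q'.
  case: q' e => [|u v a q'] e; first by rewrite (eq_axiomK e).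
  have := thin_path_rank (pcons a q').
  have /(congr1 rk) : x = v :> nat by rewrite e.
  by move=> /= -> ; lia.
case: q' e => [|u' v' a' q'] e.
  have := thin_path_rank (pcons a p).
  have /(congr1 rk) : v = x :> nat by rewrite e.
  by move=> /= ->; lia.
have euu : u = u'.
  apply: val_inj; rewrite /= (thin_path_target p) (thin_path_target q').
  have := thin_path_rank (pcons a p); have := thin_path_rank (pcons a' q').
  have /(congr1 rk) : v = v' :> nat by rewrite e.
  by move=> /= -> -> /addnI [->].
case: _ / e a' => a' /=; case: _ / euu q' a' => q' a'.
by rewrite -(IH _ erefl q') /= (@Prop_irrelevance (r u v) a a').
Qed.

End ThinPaths.

(** * Vertex maps of the paths of the configuration *)

Section Evaluation.
Variables (F : fieldType) (n : nat).
Local Notation gv := (gam_vert n).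

Definition gsize (v : gv) : nat :=
  match v with inl m => m | inr m => m end.

Definition gbase (v : gv) : nat := if v is inl _ then 3 else 1.

Definition grel (v : gv) : rel nat := if v is inl _ then relD else relA.

Definition arrow_fun (v w : gv) (a : gam_arrow v w) : nat -> nat :=
  match a with
  | gam_t _ => swap12
  | gam_piD _ _ i _ _ => bump i
  | gam_iotaD _ _ i _ _ => unbump i
  | gam_piDA _ _ i _ _ => bump i
  | gam_piA _ _ i _ _ => bump i
  | gam_iotaA _ _ i _ _ => unbump i
  end.

Fixpoint path_fun (v w : gv) (p : qpath (@gam_arrow n) v w) : nat -> nat :=
  match p with
  | pnil => id
  | pcons _ _ a p' => path_fun p' \o arrow_fun a
  end.

Lemma path_fun_cat u v w (q : qpath (@gam_arrow n) v w) (p : qpath (@gam_arrow n) u v) :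
  path_fun (pcat q p) = path_fun p \o path_fun q.
Proof. by elim: q p => //= x y a q IH p; rewrite IH. Qed.

Local Notation gthin v := (@thin (grel v) (gsize v)).

(** The type [gam_cat F v] reduces to a category of representations only once [v] is destructed;
    hence four identical branches. *)
Definition gam_pull (v w : gv) : forall phi : ivl 1 (gsize w) -> ivl 1 (gsize v),
    (forall x y, gthin w x y -> qpath (gthin v) (phi x) (phi y)) ->
    functor (gam_cat F v) (gam_cat F w) :=
  match v, w with
  | inl _, inl _ => fun phi phiE => pullback F phiE
  | inl _, inr _ => fun phi phiE => pullback F phiE
  | inr _, inl _ => fun phi phiE => pullback F phiE
  | inr _, inr _ => fun phi phiE => pullback F phiE
  end.

Definition pulls_along v w (G : functor (gam_cat F v) (gam_cat F w))
    (f : nat -> nat) : Prop :=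
  exists (phi : ivl 1 (gsize w) -> ivl 1 (gsize v)) phiE,
    (forall x, phi x = f x :> nat) /\
    nat_iso G (@gam_pull v w phi phiE).

Lemma pulls_label v w (a : gam_arrow v w) : pulls_along (gam_label F a) (arrow_fun a).
Proof.
case: a => *; (eexists; eexists; split; last exact: nat_iso_refl); by case.
Qed.

Lemma pulls_comp u v w (G : functor (gam_cat F u) (gam_cat F v))
    (H : functor (gam_cat F v) (gam_cat F w)) f g :
  pulls_along G f -> pulls_along H g -> pulls_along (fcomp H G) (f \o g).
Proof.
move=> [phi [phiE [ef iG]]] [psi [psiE [eg iH]]].
exists (phi \o psi), (fun x y a => path_subst phiE (psiE x y a)).
split=> [x|]; first by rewrite /= ef eg.
apply: (nat_iso_trans (nat_iso_comp iG iH)).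
clear G H iG iH ef eg.
by case: u phi phiE => u phi phiE; case: v phi phiE psi psiE => v phi phiE psi psiE;
  case: w psi psiE => w psi psiE; apply: pullback_comp.
Qed.

Lemma pulls_id v : pulls_along (fid (gam_cat F v)) id.
Proof.
exists id, (@parrow _ _); split=> //; case: v => v; exact: pullback_id.
Qed.

Lemma pulls_eval v w (p : qpath (@gam_arrow n) v w) :
  pulls_along (gam_eval F p) (path_fun p).
Proof.
elim: p => [|x y a p IH] /=; first exact: pulls_id.
exact: pulls_comp IH (pulls_label a).
Qed.

Lemma gthin_uniq v x y (p q : qpath (gthin v) x y) : p = q.
Proof.
case: v x y p q => m x y p q.
  (* The rank [maxn 2] puts 1 and 2 at the same level, just below 3. *)
  apply: (thin_path_uniq (s := fun x => if (x < 3)%N then 3 else x.+1)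
    (rk := maxn 2)) => {p q x y} x y; rewrite /= /relD; last lia.
  by case: ltnP => [_ /orP[/eqP|]|_ /orP[|/eqP]]; lia.
by apply: (thin_path_uniq (s := S) (rk := id)) => {p q x y} x y /eqP.
Qed.

(** Simple representations detect the vertex map; conversely, uniqueness of paths lets it determine
    the restriction functor. Vertex maps go backwards, from the vertices of [w] to those of [v], and
    their values elsewhere on [nat] are meaningless. *)
Lemma nat_iso_evalP v w (p q : qpath (@gam_arrow n) v w) :
  nat_iso (gam_eval F p) (gam_eval F q) <->
  forall x, (1 <= x <= gsize w)%N -> path_fun p x = path_fun q x.
Proof.
have [phi [phiE [ep ip]]] := pulls_eval p.
have [psi [psiE [eq iq]]] := pulls_eval q; split=> [i x xP|e].
  have {}i := nat_iso_trans (nat_iso_trans (nat_iso_sym ip) i) iq.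
  rewrite -[x]/(num (Ivl xP)) -ep -eq; congr num.
  clear p q ep eq ip iq; move: x xP i.
  by case: v phi phiE psi psiE => v phi phiE psi psiE;
    case: w phi phiE psi psiE => w phi phiE psi psiE x xP /pullback_inj.
apply: nat_iso_trans ip (nat_iso_trans _ (nat_iso_sym iq)).
have {}e : phi =1 psi.
  by move=> x; apply: val_inj; rewrite /= ep eq e //; case: x.
clear p q ep eq iq; have := @gthin_uniq v; move: e.
by case: v phi phiE psi psiE => v phi phiE psi psiE;
  case: w phi phiE psi psiE => w phi phiE psi psiE e uE; apply: pullback_eq.
Qed.

End Evaluation.

(** * The configuration algebra *)

Section ConfigurationAlgebra.
Variables (k : comNzRingType) (F : fieldType) (n : nat).
Local Notation gv := (gam_vert n).
Local Notation gpath := (qpath (@gam_arrow n)).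
Local Notation A := (kD1 k F n).

Definition cls (v w : gv) (p : gpath v w) : A :=
  iquot_pi (gam_relation F (n := n)) (basis k p).

Lemma arrow_fun_range v w (a : @gam_arrow n v w) x :
  (1 <= x <= gsize w -> 1 <= arrow_fun a x <= gsize v)%N.
Proof.
case: a => /= [m|m p i|m p i|m p i|m p i|m p i];
  rewrite ?/swap12 ?/bump ?/unbump; [|move/eqP..].
  by have := ivl_lb m; do 2?case: eqP; lia.
all: by lia.
Qed.

Lemma path_fun_range v w (p : gpath v w) x :
  (1 <= x <= gsize w -> 1 <= path_fun p x <= gsize v)%N.
Proof. by elim: p x => //= u z a p IH x xP; apply/IH/arrow_fun_range. Qed.

Lemma cls_eq v w (p q : gpath v w) :
  (forall x, 1 <= x <= gsize w -> path_fun p x = path_fun q x)%N ->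
  cls p = cls q.
Proof.
move=> e; apply/iquot_piP/asboolP => J _; apply; constructor.
exact/nat_iso_evalP.
Qed.

Lemma cls_cat u v w (q : gpath v w) (p : gpath u v) :
  cls q * cls p = cls (pcat q p).
Proof. by rewrite -(rmorphM (iquot_pi _)) /= basis_cat. Qed.

Lemma cls_mul0 u v v' w (q : gpath v' w) (p : gpath u v) :
  v <> v' -> cls q * cls p = 0.
Proof. by move=> ne; rewrite -(rmorphM (iquot_pi _)) /= basis_mul0 ?raddf0. Qed.

Definition realizes v w (p : gpath v w) (f : nat -> nat) : Prop :=
  forall x, (1 <= x <= gsize w)%N -> path_fun p x = f x.

Definition realizable v w f : Prop := exists p : gpath v w, realizes p f.

(* The class of the paths with vertex map [f], or [0] if there is no such path. *)
Definition cl v w f : A :=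
  if pselect (realizable v w f) is left h then cls (projT1 (cid h)) else 0.

Lemma cl_cls v w (p : gpath v w) f : realizes p f -> cl v w f = cls p.
Proof.
move=> pf; rewrite /cl; case: pselect => [h|[]]; last by exists p.
by case: cid => q qf /=; apply: cls_eq => x xP; rewrite qf ?pf.
Qed.

Lemma cls_cl v w (p : gpath v w) : cls p = cl v w (path_fun p).
Proof. by rewrite (cl_cls (p := p)). Qed.

Lemma realizable_ext v w f g :
  (forall x, 1 <= x <= gsize w -> f x = g x)%N ->
  realizable v w f -> realizable v w g.
Proof. by move=> fg [p pf]; exists p => x xP; rewrite pf ?fg. Qed.

Lemma cl_ext v w f g :
  (forall x, 1 <= x <= gsize w -> f x = g x)%N -> cl v w f = cl v w g.
Proof.
move=> fg; case: (pselect (realizable v w f)) => [[p pf]|nf].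
  by rewrite (cl_cls pf) (@cl_cls _ _ p g) // => x xP; rewrite pf ?fg.
rewrite /cl; case: pselect => // _; case: pselect => // rg; case: nf.
by apply: realizable_ext rg => x xP; rewrite fg.
Qed.

Lemma realizable_comp u v w f g :
  realizable u v f -> realizable v w g -> realizable u w (f \o g).
Proof.
move=> [p pf] [q qg]; exists (pcat q p) => x xP.
by rewrite path_fun_cat /= qg // pf // -qg // path_fun_range.
Qed.

Lemma clM u v w f g : realizable u v f -> realizable v w g ->
  cl v w g * cl u v f = cl u w (f \o g).
Proof.
move=> [p pf] [q qg]; rewrite (cl_cls pf) (cl_cls qg) cls_cat.
rewrite (@cl_cls _ _ (pcat q p)) // => x xP.
by rewrite path_fun_cat /= qg // pf // -qg // path_fun_range.
Qed.

Lemma clM0 u v v' w f g : v != v' -> cl v' w g * cl u v f = 0.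
Proof.
move=> /eqP ne; rewrite /cl; case: pselect => [h|_]; last by rewrite mul0r.
by case: pselect => [h'|_]; rewrite ?mulr0 // cls_mul0.
Qed.

Definition one v : A := cls (@pnil _ (@gam_arrow n) v).

Lemma oneE v : one v = cl v v id. Proof. exact: cls_cl. Qed.

Lemma realizable_id v : realizable v v id.
Proof. by exists pnil. Qed.

Lemma sum_one : \sum_v one v = 1.
Proof.
by rewrite -(rmorph1 (iquot_pi _)) path_algebra1 raddf_sum.
Qed.

Lemma one_cls v w (p : gpath v w) : one w * cls p = cls p.
Proof. by rewrite cls_cat. Qed.

Lemma cls_one v w (p : gpath v w) : cls p * one v = cls p.
Proof. by rewrite cls_cat pcatp0. Qed.

Lemma oneM v w : one v * one w = if v == w then one v else 0.
Proof.
case: eqP => [<-|ne]; first exact: one_cls.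
by rewrite cls_mul0 // => /esym.
Qed.

Lemma one_ext x y : (forall v, x * one v = y * one v) -> x = y.
Proof.
move=> e; rewrite -[x]mulr1 -[y]mulr1 -sum_one !mulr_sumr.
by apply: eq_bigr => v _.
Qed.

(** An operator acts at all vertices of its domain at once, so that one identity in the algebra
    covers all sizes m. *)
Record operator := Operator {
  odom : pred gv; otgt : gv -> gv; ofun : nat -> nat;
  oP : forall v, odom v -> realizable v (otgt v) ofun }.

Definition oval (o : operator) : A := \sum_(v | odom o v) cl v (otgt o v) (ofun o).

Lemma oval_cl o u v f : realizable u v f ->
  oval o * cl u v f = if odom o v then cl u (otgt o v) (f \o ofun o) else 0.
Proof.
move=> rf; rewrite /oval mulr_suml; case: ifP => dv.
  rewrite (bigD1 v) //= clM //; last exact: oP.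
  by rewrite big1 ?addr0 // => w /andP[_ wv]; rewrite clM0 // eq_sym.
by rewrite big1 // => w dw; rewrite clM0 //; apply: contraFneq dv => ->.
Qed.

Fixpoint wtgt (w : seq operator) v :=
  if w is o :: w' then otgt o (wtgt w' v) else v.
Fixpoint wdom (w : seq operator) v :=
  if w is o :: w' then wdom w' v && odom o (wtgt w' v) else true.
Fixpoint wfun (w : seq operator) : nat -> nat :=
  if w is o :: w' then wfun w' \o ofun o else id.
Fixpoint wval (w : seq operator) : A :=
  if w is o :: w' then oval o * wval w' else 1.

Lemma wvalP w u v f : realizable u v f ->
  (wdom w v -> realizable u (wtgt w v) (f \o wfun w)) /\
  wval w * cl u v f = if wdom w v then cl u (wtgt w v) (f \o wfun w) else 0.
Proof.
move=> rf; elim: w => [|o w [IH1 IH2]] /=; first by rewrite mul1r.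
rewrite -mulrA IH2; case: (boolP (wdom w v)) => /= dw; last by rewrite mulr0.
rewrite oval_cl; last exact: IH1.
by split=> // dov; apply: realizable_comp (IH1 dw) (oP dov).
Qed.

Lemma wval_one w v :
  wval w * one v = if wdom w v then cl v (wtgt w v) (wfun w) else 0.
Proof. by rewrite oneE (wvalP w (realizable_id v)).2. Qed.

Definition isD (v : gv) : bool := if v is inl _ then true else false.

Lemma gam_vert_eq (v w : gv) : isD v = isD w -> gsize v = gsize w -> v = w.
Proof. by case: v w => m [] p //= _ e; congr (_ _); apply: val_inj. Qed.

Lemma wval_eq w w' :
  (forall v, wdom w v = wdom w' v /\
    (wdom w v -> [/\ isD (wtgt w v) = isD (wtgt w' v),
      gsize (wtgt w v) = gsize (wtgt w' v) &
      forall x, (1 <= x <= gsize (wtgt w v))%N -> wfun w x = wfun w' x])) ->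
  wval w = wval w'.
Proof.
move=> ww'; apply: one_ext => v; rewrite !wval_one; have [<-] := ww' v.
case: ifP => // _ /(_ isT) [eD eS ef].
by rewrite -(gam_vert_eq eD eS); apply: cl_ext.
Qed.

Lemma gbaseE v : gbase v = if isD v then 3 else 1. Proof. by case: v. Qed.

Lemma gsize_bounds v :
  ((if isD v then 3 else 2) <= gsize v <= (if isD v then n.+1 else n))%N.
Proof. by case: v => m; apply: numP. Qed.

(** At the smallest size the default value of [insubd] leaves the vertex unchanged, whence the
    boolean subtracted in [gsize_pred]. *)
Definition gpred (v : gv) : gv :=
  match v with
  | inl m => inl (insubd m m.-1)
  | inr m => inr (insubd m m.-1)
  end.

Lemma isD_pred v : isD (gpred v) = isD v. Proof. by case: v. Qed.

Lemma gsize_pred v :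
  gsize (gpred v) = (gsize v - ((if isD v then 3 else 2) < gsize v))%N.
Proof.
case: v => m /=; have := numP m; have := val_insubd m m.-1; rewrite /= => -> mb;
  by case: ifP; lia.
Qed.

Fact toA_subproof (m : ivl 3 n.+1) : (2 <= m.-1 <= n)%N.
Proof. by have := numP m; lia. Qed.

Definition toA (v : gv) : gv :=
  match v with
  | inl m => inr (Ivl (toA_subproof m))
  | inr m => inr m
  end.

Lemma isD_toA v : isD (toA v) = false. Proof. by case: v. Qed.

Lemma gsize_toA v :
  gsize (toA v) = if isD v then (gsize v).-1 else gsize v.
Proof. by case: v. Qed.

(* Vertex map of [iota_(i-1)] after [pi_i]. *)
Definition nu (i x : nat) : nat := (x - (x == i))%N.

Lemma swap12E x : swap12 x = (x + (x == 1) - (x == 2))%N.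
Proof. by rewrite /swap12; case: x => [|[|[|x]]] //=; lia. Qed.

Lemma opU_factor i v : (gbase v < i < gsize v)%N ->
  exists (q : gpath (gpred v) v) (p : gpath v (gpred v)),
    realizes (pcat q p) (nu i) /\ (gsize (gpred v) < gsize v)%N.
Proof.
have sp := gsize_pred v; have := gsize_bounds v; case: v sp => m /= sp mb ib.
  have e : m == (num (insubd m m.-1)).+1 :> nat by rewrite sp; lia.
  have i1 : (3 <= i < m)%N by lia.
  have i2 : (3 <= i.-1 <= m - 2)%N by lia.
  exists (parrow (gam_iotaD e i2)), (parrow (gam_piD e i1)).
  by split=> [x _|]; rewrite /= ?sp ?/nu ?/bump ?/unbump; lia.
have e : m == (num (insubd m m.-1)).+1 :> nat by rewrite sp; lia.
have i1 : (1 <= i < m)%N by lia.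
have i2 : (1 <= i.-1 <= m - 2)%N by lia.
exists (parrow (gam_iotaA e i2)), (parrow (gam_piA e i1)).
by split=> [x _|]; rewrite /= ?sp ?/nu ?/bump ?/unbump; lia.
Qed.

Fact opU_subproof i v : (gbase v < i < gsize v)%N -> realizable v v (nu i).
Proof. by move=> /opU_factor [q [p [qp _]]]; exists (pcat q p). Qed.

Definition opU i := Operator (@opU_subproof i).

Fact opT_subproof v : isD v -> realizable v v swap12.
Proof. by case: v => // m _; exists (parrow (gam_t m)). Qed.

Definition opT := Operator opT_subproof.

Fact opP1_subproof v : ~~ isD v && (2 < gsize v)%N ->
  realizable v (gpred v) (bump 1).
Proof.
have sp := gsize_pred v; have := gsize_bounds v; case: v sp => m //= sp mb ib.
have e : m == (num (insubd m m.-1)).+1 :> nat by rewrite sp; lia.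
have i1 : (1 <= 1 < m)%N by lia.
by exists (parrow (gam_piA e i1)).
Qed.

Definition opP1 := Operator opP1_subproof.

Fact opP2_subproof v : isD v -> realizable v (toA v) (bump 2).
Proof.
case: v => // m _; have := numP m => mb.
have e : m == (m.-1).+1 :> nat by lia.
by exists (parrow (@gam_piDA n m (Ivl (toA_subproof m)) 2 e isT)).
Qed.

(** No operator is introduced for pi_1 on D_m, because it equals pi_2 t: on positive integers
    [swap12 \o bump 2] is [bump 1]. *)
Definition opP2 := Operator opP2_subproof.

Fact opP3_subproof v : isD v && (3 < gsize v)%N ->
  realizable v (gpred v) (bump 3).
Proof.
have sp := gsize_pred v; have := gsize_bounds v; case: v sp => m //= sp mb ib.
have e : m == (num (insubd m m.-1)).+1 :> nat by rewrite sp; lia.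
have i1 : (3 <= 3 < m)%N by lia.
by exists (parrow (gam_piD e i1)).
Qed.

Definition opP3 := Operator opP3_subproof.

(** Once a vertex is replaced by its type and size, domains, targets and vertex maps are compared by
    linear arithmetic. *)
Ltac word_eq :=
  apply: wval_eq; let v := fresh "v" in intro v;
  have := gsize_bounds v; rewrite /= ?gbaseE;
  rewrite ?(isD_pred, isD_toA, gsize_pred, gsize_toA, gbaseE);
  move: (isD v) (gsize v) => [] ? ? /=;
  rewrite /nu /bump; (split; [|move=> ?; split=> [||?]]);
  rewrite ?isD_pred ?isD_toA //= ?swap12E; lia.

Lemma opUU_comm i j : (i.+1 < j)%N ->
  wval [:: opU i; opU j] = wval [:: opU j; opU i].
Proof. move=> ij; word_eq. Qed.

Lemma opUU i : wval [:: opU i; opU i] = wval [:: opU i].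
Proof. word_eq. Qed.

Lemma opUUU1 i : wval [:: opU i.+1; opU i; opU i.+1] = wval [:: opU i.+1; opU i].
Proof. word_eq. Qed.

Lemma opUUU2 i : wval [:: opU i; opU i.+1; opU i] = wval [:: opU i.+1; opU i].
Proof. word_eq. Qed.

Lemma opUT i : wval [:: opU i; opT] = wval [:: opT; opU i].
Proof. word_eq. Qed.

Lemma opTT v : wval [:: opT; opT] * one v = if isD v then one v else 0.
Proof.
rewrite wval_one /=; case: (isD v) => //=; rewrite oneE; apply: cl_ext => x.
by rewrite /= !swap12E; lia.
Qed.

Lemma opUP1 i : (2 <= i)%N -> wval [:: opU i; opP1] = wval [:: opP1; opU i.+1].
Proof. move=> i2; word_eq. Qed.

Lemma opUP2 i : (3 <= i)%N -> wval [:: opU i; opP2] = wval [:: opP2; opU i.+1].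
Proof. move=> i2; word_eq. Qed.

Lemma opUP3 i : (4 <= i)%N -> wval [:: opU i; opP3] = wval [:: opP3; opU i.+1].
Proof. move=> i2; word_eq. Qed.

(** The vertex map x |-> x + 2 misses 2, so [nu 2] changes nothing. The same holds for 4 in [opP3P3]
    and in [opUP2P3]. *)
Lemma opP1P1 : wval [:: opP1; opP1] = wval [:: opP1; opP1; opU 2].
Proof. word_eq. Qed.

Lemma opP3P3 : wval [:: opP3; opP3] = wval [:: opP3; opP3; opU 4].
Proof. word_eq. Qed.

Lemma opTP3 : wval [:: opT; opP3] = wval [:: opP3; opT].
Proof. word_eq. Qed.

(** The vertex map x |-> x + 2 misses both 1 and 2. *)
Lemma opP1P2T : wval [:: opP1; opP2; opT] = wval [:: opP1; opP2].
Proof. word_eq. Qed.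

(** Both vertex maps fix 1 and shift every later vertex by two. *)
Lemma opP1UP2 : wval [:: opP1; opU 2; opP2] = wval [:: opP2; opP3].
Proof. word_eq. Qed.

Lemma opUP2P3 : wval [:: opU 2; opP2; opP3] = wval [:: opU 2; opP2; opP3; opU 4].
Proof. word_eq. Qed.

End ConfigurationAlgebra.

(** * Identities in an arbitrary ring *)

Section RingIdentities.
Variable R : pzRingType.
Implicit Types x y z t : R.

Lemma mul0_absl x y t : x * t = x -> t * y = 0 -> x * y = 0.
Proof. by move=> <- e; rewrite -mulrA e mulr0. Qed.

Lemma mul0_absr x y t : x * t = 0 -> t * y = y -> x * y = 0.
Proof. by move=> e <-; rewrite mulrA e mul0r. Qed.

Lemma mul0_assoc x y z t : x * y = 0 -> x * (y * z * t) = 0.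
Proof. by move=> e; rewrite !mulrA e !mul0r. Qed.

Lemma mul_sandwich x y z : x * y = y * x -> x * (y * z * y) = y * (x * z) * y.
Proof. by move=> xy; rewrite !mulrA xy. Qed.

Lemma mul_swap t d z : t * d = d * t -> d * (t * 1 * z) = t * (d * 1) * z.
Proof. by move=> td; rewrite !mulr1 !mulrA td. Qed.

Lemma mul_swap0 t d z : t * d = d * t -> d * d = 0 -> d * (t * (d * 1) * z) = 0.
Proof. by move=> td dd; rewrite mulr1 !mulrA -td -(mulrA t) dd mulr0 mul0r. Qed.

Lemma mul_square t u z : t * t = u -> t * (t * 1 * z) = u * z.
Proof. by move=> <-; rewrite mulr1 mulrA. Qed.

Lemma mul_square_absorb t u d z : t * t = u -> u * d = d ->
  t * (t * (d * 1) * z) = d * 1 * z.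
Proof. by move=> tt ud; rewrite !mulr1 !mulrA tt ud. Qed.

Lemma mul_last x y t d z : x * y * t * d = x * y * d ->
  x * (y * (t * (d * 1)) * z) = x * (y * (d * 1)) * z.
Proof. by move=> e; rewrite !mulr1 !mulrA e. Qed.

Lemma mul_opp2 x z : - (- x * z) = x * z.
Proof. by rewrite mulNr opprK. Qed.

Lemma sub_congr x x' y y' : x = x' -> y = y' -> x - y = x' - y'.
Proof. by move=> -> ->. Qed.

Lemma mul_subN x y z : (x - y) * z - - y * z = x * z.
Proof. by rewrite -mulrBl opprK subrK. Qed.

Lemma mul_act a c d t z : a * c * t = a * c - c * d + c * t * d ->
  (a * (c * 1) - c * (d * 1)) * z - - (c * (t * (d * 1))) * z =
  a * (c * (t * 1)) * z.
Proof. by move=> e; rewrite -mulrBl opprK !mulr1 !mulrA e. Qed.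

Lemma mul0_left x y z : x * y = 0 -> x * (y * z) = 0.
Proof. by move=> e; rewrite mulrA e mul0r. Qed.

Lemma mul_target x y z t : x * y = t * (x * y) -> x * (y * z) = t * (x * (y * z)).
Proof. by move=> e; rewrite mulrA {1}e -!mulrA. Qed.

(** The correction [u] contributes - q r e to the first product, which cancels against the second;
    the remaining term u q r e contains u' e = 0. *)
Lemma cone_identity (u u' p q r e : R) : p * u * q = q * r ->
  u * q * r = u * q * r * u' -> u' * e = 0 -> e * (r * e) = r * e ->
  p * ((1 - u) * (q * e)) + (1 - u) * (q * e) * (r * e) = p * q * e.
Proof.
move=> pu ur ue re; rewrite -(mulrA (1 - u)) -(mulrA q) re.
rewrite (mulrA q) !mulrBl !mul1r mulrBr !mulrA pu ur.
by rewrite -(mulrA _ u') ue mulr0 subr0 subrK.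
Qed.

End RingIdentities.

(** Both equations say cd + act = ac + ctd. *)
Lemma commuting_relation (R : pzRingType) (a c d t : R) : t * d = d * t ->
  (c - c * t) * d = a * (c - c * t) <-> (a * c - c * d) * t = a * c - c * d.
Proof.
move=> td; rewrite !mulrBl mulrBr -!mulrA -td.
move: (c * d) (c * (t * d)) (a * c) (a * (c * t)) => x y z w.
by split=> e; [have := congr1 (+%R (w - x)) e | have := congr1 (+%R (x - w)) e];
  rewrite addrA subrK [X in _ = X]addrC addrA subrK.
Qed.

(** * The normalizing idempotent *)

Section NormalizingIdempotent.
Variables (R : pzRingType) (u : nat -> R).
Hypothesis uu : forall i, u i * u i = u i.
Hypothesis u_comm : forall i j, (i.+1 < j)%N -> u i * u j = u j * u i.
Hypothesis u_braid1 : forall i, u i.+1 * u i * u i.+1 = u i.+1 * u i.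
Hypothesis u_braid2 : forall i, u i * u i.+1 * u i = u i.+1 * u i.

(** The hypotheses are the relations of the Catalan monoid of order-preserving regressive maps. The
    first braid relation gives annihilation by the [u j] on the left, the second on the right. *)
Definition nidem a b : R := \prod_(a <= i < b) (1 - u i).

Lemma nidem_fix a b x :
  (forall j, (a <= j < b)%N -> u j * x = 0) -> nidem a b * x = x.
Proof.
rewrite /nidem; elim: b => [|b IH] ux; first by rewrite big_nil mul1r.
case: (leqP a b) => ab; last by rewrite big_geq ?mul1r.
rewrite big_nat_recr //= -mulrA mulrBl mul1r ux ?subr0; last by lia.
by apply: IH => j jb; apply: ux; lia.
Qed.

Lemma mul_nidem a b j : (a <= j < b)%N -> u j * nidem a b = 0.
Proof.
have [d] := ubnP (b - a); elim: d a => // d IH a bd jab.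
rewrite /nidem big_ltn; last by lia.
rewrite -/(nidem a.+1 b) mulrA; have [ja|ja] := eqVneq j a.
  by rewrite ja mulrBr mulr1 uu subrr mul0r.
have IHj : u j * nidem a.+1 b = 0 by apply: IH; lia.
have [ja1|ja1] := eqVneq j a.+1.
  (* With N the rest of the product, the braid relation gives u_{a+1} (1 - u_a) N = (1 - u_{a+1}
     u_a) u_{a+1} N, and u_{a+1} N = 0 by induction. *)
  move: IHj; rewrite ja1 mulrBr mulr1 -u_braid1 => IHj.
  by rewrite -[X in X - _]mul1r -mulrBl -mulrA IHj mulr0.
rewrite mulrBr mulr1 -u_comm; last by lia.
by rewrite -[X in X - _]mul1r -mulrBl -mulrA IHj mulr0.
Qed.

Lemma nidem_mul a b j : (a <= j < b)%N -> nidem a b * u j = 0.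
Proof.
elim: b => [|b IH] jab; first by lia.
rewrite /nidem big_nat_recr /=; last by lia.
rewrite -/(nidem a b) -mulrA; have [jb|jb] := eqVneq j b.
  by rewrite jb mulrBl mul1r uu subrr mulr0.
have IHj : nidem a b * u j = 0 by apply: IH; lia.
have [jb1|jb1] := eqVneq b j.+1.
  move: IHj; rewrite jb1 mulrBl mul1r -u_braid2 -mulrA => IHj.
  by rewrite -[X in X - _]mulr1 -mulrBr mulrA IHj mul0r.
rewrite mulrBl mul1r -u_comm; last by lia.
by rewrite -[X in X - _]mulr1 -mulrBr mulrA IHj mul0r.
Qed.

Lemma nidem_comm a b t :
  (forall j, u j * t = t * u j) -> nidem a b * t = t * nidem a b.
Proof.
move=> ut; rewrite /nidem; elim: b => [|b IH]; first by rewrite big_nil mul1r mulr1.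
case: (leqP a b) => ab; last by rewrite big_geq ?mul1r ?mulr1.
have tu : (1 - u b) * t = t * (1 - u b).
  by rewrite mulrBl mulrBr mul1r mulr1 ut.
by rewrite big_nat_recr //= -mulrA tu mulrA IH mulrA.
Qed.

Lemma additive_nidem (W : zmodType) (h : {additive R -> W}) a b x :
  (forall j y, h (u j * y) = 0) -> h (nidem a b * x) = h x.
Proof.
move=> hu; have [d] := ubnP (b - a); elim: d a => // d IH a bd.
case: (leqP b a) => ab; first by rewrite /nidem big_geq ?mul1r.
rewrite /nidem big_ltn // -mulrA mulrBl mul1r raddfB hu subr0.
by apply: IH; lia.
Qed.

Lemma additive_nidemr (W : zmodType) (h : {additive R -> W}) a b x :
  (forall j y, h (y * u j) = 0) -> h (x * nidem a b) = h x.
Proof.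
move=> hu; elim: b => [|b IH]; first by rewrite /nidem big_nil mulr1.
case: (leqP a b) => ab; last by rewrite /nidem big_geq ?mulr1.
by rewrite /nidem big_nat_recr //= mulrA mulrBr mulr1 raddfB hu subr0.
Qed.

Lemma nidem_congr a b (J : R -> Prop) x :
  J 0 -> (forall y z, J y -> J z -> J (y + z)) -> (forall y z, J z -> J (y * z)) ->
  (forall i, J (u i * x)) -> J (x - nidem a b * x).
Proof.
move=> J0 JD JM Ju; rewrite /nidem; elim: b => [|b IH].
  by rewrite big_nil mul1r subrr.
case: (leqP a b) => ab; last by rewrite big_geq ?mul1r ?subrr.
rewrite big_nat_recr //= -mulrA mulrBl mul1r mulrBr opprB addrCA addrC.
by apply: JD IH (JM _ _ (Ju b)).
Qed.

End NormalizingIdempotent.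

(** * Normalized elements of the configuration algebra *)

Section NormalizedElements.
Variables (k : comNzRingType) (F : fieldType) (n : nat).
Local Notation A := (kD1 k F n).
Local Notation one := (one k F (n := n)).
Local Notation cl := (cl k F (n := n)).
Local Notation oval := (oval k F).

Definition eU i : A := oval (opU n i).
Definition eT : A := oval (opT n).
Definition eP1 : A := oval (opP1 n).
Definition eP2 : A := oval (opP2 n).
Definition eP3 : A := oval (opP3 n).

Lemma eUU i : eU i * eU i = eU i.
Proof. by have := opUU k F n i; rewrite /= !mulr1. Qed.
Lemma eU_comm i j : (i.+1 < j)%N -> eU i * eU j = eU j * eU i.
Proof. by move=> ij; have := opUU_comm k F n ij; rewrite /= !mulr1. Qed.
Lemma eU_braid1 i : eU i.+1 * eU i * eU i.+1 = eU i.+1 * eU i.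
Proof. by have := opUUU1 k F n i; rewrite /= !mulr1 !mulrA. Qed.
Lemma eU_braid2 i : eU i * eU i.+1 * eU i = eU i.+1 * eU i.
Proof. by have := opUUU2 k F n i; rewrite /= !mulr1 !mulrA. Qed.
Lemma eUT i : eU i * eT = eT * eU i.
Proof. by have := opUT k F n i; rewrite /= !mulr1. Qed.
Lemma eUP1 i : (2 <= i)%N -> eU i * eP1 = eP1 * eU i.+1.
Proof. by move=> i2; have := opUP1 k F n i2; rewrite /= !mulr1. Qed.
Lemma eUP2 i : (3 <= i)%N -> eU i * eP2 = eP2 * eU i.+1.
Proof. by move=> i2; have := opUP2 k F n i2; rewrite /= !mulr1. Qed.
Lemma eUP3 i : (4 <= i)%N -> eU i * eP3 = eP3 * eU i.+1.
Proof. by move=> i2; have := opUP3 k F n i2; rewrite /= !mulr1. Qed.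
Lemma eP1P1 : eP1 * eP1 = eP1 * eP1 * eU 2.
Proof. by have := opP1P1 k F n; rewrite /= !mulr1 !mulrA. Qed.
Lemma eP3P3 : eP3 * eP3 = eP3 * eP3 * eU 4.
Proof. by have := opP3P3 k F n; rewrite /= !mulr1 !mulrA. Qed.
Lemma eTP3 : eT * eP3 = eP3 * eT.
Proof. by have := opTP3 k F n; rewrite /= !mulr1. Qed.
Lemma eP1P2T : eP1 * eP2 * eT = eP1 * eP2.
Proof. by have := opP1P2T k F n; rewrite /= !mulr1 !mulrA. Qed.
Lemma eP1UP2 : eP1 * eU 2 * eP2 = eP2 * eP3.
Proof. by have := opP1UP2 k F n; rewrite /= !mulr1 !mulrA. Qed.
Lemma eUP2P3 : eU 2 * eP2 * eP3 = eU 2 * eP2 * eP3 * eU 4.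
Proof. by have := opUP2P3 k F n; rewrite /= !mulr1 !mulrA. Qed.

Lemma oval_one o v :
  oval o * one v = if odom o v then cl v (otgt o v) (ofun o) else 0.
Proof. by rewrite oneE oval_cl //; apply: realizable_id. Qed.

Lemma one_oval_one o v : one (otgt o v) * (oval o * one v) = oval o * one v.
Proof.
rewrite oval_one; case: ifP => [dv|]; last by rewrite mulr0.
by rewrite oneE clM //; [apply: oP|apply: realizable_id].
Qed.

Lemma one_eU v i : one v * eU i = eU i * one v.
Proof.
apply: one_ext => w; rewrite -!mulrA oneM; case: eqP => [<-|ne].
  by rewrite (one_oval_one (opU n i)).
by rewrite mulr0 -(one_oval_one (opU n i) w) mulrA oneM /= (introF eqP ne) mul0r.
Qed.

Lemma eTT v : isD v -> eT * (eT * one v) = one v.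
Proof. by move=> Dv; have := opTT k F v; rewrite /= Dv mulr1 mulrA. Qed.

(** The interior indices of every A_m and D_m of the configuration lie between 2 and n, so a single
    product serves as projector at all vertices. *)
Lemma eU0 i : ~~ (2 <= i <= n)%N -> eU i = 0.
Proof.
move=> iP; apply: one_ext => v; rewrite mul0r /eU oval_one /= gbaseE ifF //.
by apply: contraNF iP; have := gsize_bounds v; case: (isD v); lia.
Qed.

(* The Dold-Kan projector onto the elements killed by every [pi_i], except for the
   least [i] (1 on [A_m], 3 on [D_m]), along the sum of the images of the [iota_i]. *)
Definition ide : A := nidem eU 2 n.+1.

Lemma eU_ide i : eU i * ide = 0.
Proof.
case: (boolP (2 <= i <= n)%N) => iP; last by rewrite eU0 ?mul0r.
exact: (mul_nidem eUU eU_comm eU_braid1).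
Qed.

Lemma ide_eU i : ide * eU i = 0.
Proof.
case: (boolP (2 <= i <= n)%N) => iP; last by rewrite eU0 ?mulr0.
exact: (nidem_mul eUU eU_comm eU_braid2).
Qed.

Lemma ide_fix x : (forall j, eU j * x = 0) -> ide * x = x.
Proof. by move=> ux; apply: nidem_fix. Qed.

Lemma ide_idem : ide * ide = ide.
Proof. by apply: ide_fix => j; apply: eU_ide. Qed.

Lemma ideT : ide * eT = eT * ide.
Proof. by apply: nidem_comm; apply: eUT. Qed.

Lemma ide_one v : ide * one v = one v * ide.
Proof. by apply: nidem_comm => j; rewrite one_eU. Qed.

Lemma eU_tail o i x : eU i * oval o = oval o * eU i.+1 ->
  eU i * (oval o * (ide * x)) = 0.
Proof. by move=> uo; rewrite mulrA uo -mulrA (mulrA (eU _)) eU_ide mul0r mulr0. Qed.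

Lemma ideP1 : ide * (eP1 * ide) = eP1 * ide.
Proof.
apply: ide_fix => j; case: (leqP 2 j) => j2; last by rewrite eU0 ?mul0r //; lia.
by rewrite -{1}[ide]mulr1 eU_tail //; apply: eUP1.
Qed.

Lemma eUP3_low i : (i < 4)%N -> eU i * eP3 = 0.
Proof.
move=> i4; rewrite -[RHS](mul0r 1); apply: one_ext => v.
have := wval_one k F [:: opU n i; opP3 n] v; rewrite /= mulr1 => ->.
rewrite mulr1 mul0r ifF // gbaseE isD_pred.
by case: (isD v) => //=; lia.
Qed.

Lemma ideP3 : ide * (eP3 * ide) = eP3 * ide.
Proof.
apply: ide_fix => j; case: (leqP 4 j) => j4.
  by rewrite -{1}[ide]mulr1 eU_tail //; apply: eUP3.
by rewrite mulrA eUP3_low ?mul0r.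
Qed.

(** Moving [eU i] past [eP2] produces [eU i.+1], which [ide] kills, as long as 3 <= i. The index 2
    is left over, as D_m has no merging of 3 with 2. *)
Lemma ideP2 : ide * (eP2 * ide) = (1 - eU 2) * (eP2 * ide).
Proof.
have fix3 : nidem eU 3 n.+1 * (eP2 * ide) = eP2 * ide.
  apply: nidem_fix => j /andP[j3 _].
  by rewrite -{1}[ide]mulr1 eU_tail //; apply: eUP2.
case: (leqP 2 n) => n2.
  by rewrite {1}/ide /nidem big_ltn ?ltnS // -mulrA fix3.
by rewrite (eU0 (i := 2)) ?subr0 ?mul1r /ide /nidem ?big_geq ?mul1r //; lia.
Qed.

Definition eC : A := (1 - eU 2) * (eP2 * ide).

Lemma ide_eC : ide * eC = eC.
Proof. by rewrite /eC -ideP2 mulrA ide_idem. Qed.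

Lemma eP1P1_ide : eP1 * ide * (eP1 * ide) = 0.
Proof. by rewrite -mulrA ideP1 mulrA eP1P1 -mulrA eU_ide mulr0. Qed.

Lemma eP3P3_ide : eP3 * ide * (eP3 * ide) = 0.
Proof. by rewrite -mulrA ideP3 mulrA eP3P3 -mulrA eU_ide mulr0. Qed.

Lemma eP1P2_ide : eP1 * ide * eC + eC * (eP3 * ide) = eP1 * eP2 * ide.
Proof.
rewrite -mulrA ide_eC /eC.
exact: cone_identity eP1UP2 eUP2P3 (eU_ide 4) ideP3.
Qed.

End NormalizedElements.

(** * The bound quiver algebra *)

Section BoundQuiverAlgebra.
Variables (k : comNzRingType) (n : nat).
Local Notation bv := (bq_vert n).
Local Notation barrow := (@bq_arrow n).
Local Notation B := (kBQ k n).

Definition bcls (x y : bv) (p : qpath barrow x y) : B :=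
  iquot_pi (@bq_relation k n) (basis k p).

Definition bE (x : bv) : B := bcls (@pnil _ barrow x).

Lemma bcls_cat x y z (q : qpath barrow y z) (p : qpath barrow x y) :
  bcls q * bcls p = bcls (pcat q p).
Proof. by rewrite -(rmorphM (iquot_pi _)) /= basis_cat. Qed.

Lemma bcls_mul0 x y y' z (q : qpath barrow y' z) (p : qpath barrow x y) :
  y <> y' -> bcls q * bcls p = 0.
Proof. by move=> ne; rewrite -(rmorphM (iquot_pi _)) /= basis_mul0 ?raddf0. Qed.

Lemma bE_bcls x y (p : qpath barrow x y) : bE y * bcls p = bcls p.
Proof. by rewrite bcls_cat. Qed.

Lemma bEM x y : bE x * bE y = if x == y then bE x else 0.
Proof.
case: eqP => [<-|ne]; first exact: bE_bcls.
by rewrite bcls_mul0 // => /esym.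
Qed.

Lemma sum_bE : \sum_x bE x = 1.
Proof. by rewrite -(rmorph1 (iquot_pi _)) path_algebra1 raddf_sum. Qed.

Lemma bE_ext x y : (forall v, x * bE v = y * bE v) -> x = y.
Proof.
move=> e; rewrite -[x]mulr1 -[y]mulr1 -sum_bE !mulr_sumr.
by apply: eq_bigr => v _.
Qed.

Inductive bkind := Kd | Ka | Kc | Kt.

Definition akind x y (a : barrow x y) : bkind :=
  match a with bq_d _ _ _ => Kd | bq_a _ _ _ => Ka
  | bq_c _ _ _ => Kc | bq_t _ => Kt end.

Fact bdown_subproof (j : ivl 2 n) : (1 <= j.-1 <= n.-1)%N.
Proof. by have := numP j; lia. Qed.

Definition bdown (j : ivl 2 n) : ivl 1 n.-1 := Ivl (bdown_subproof j).

Fact bdownP (j : ivl 2 n) : j == (bdown j).+1 :> nat.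
Proof. by have := numP j; rewrite /=; lia. Qed.

Definition ivl_pred c d (j : ivl c d) : ivl c d := insubd j j.-1.

Lemma ivl_predE c d (j : ivl c d) : ivl_pred j = (j - (c < j))%N :> nat.
Proof.
have := val_insubd j j.-1; have := numP j; rewrite -/(ivl_pred j) /= => jb ->.
by case: ifP; lia.
Qed.

(** Each vertex emits at most one arrow of each kind. Matching on [=P true] supplies the proof that
    the arrow constructors take as argument. *)
Definition bout (K : bkind) (x : bv) : option {y : bv & barrow x y} :=
  match K, x with
  | Kt, inl j => Some (existT _ (inl j) (bq_t j))
  | Kc, inl j => Some (existT _ (inr (bdown j)) (bq_c (bdownP j)))
  | Kd, inl j =>
      if (j == (ivl_pred j).+1 :> nat) =P true is ReflectT h
      then Some (existT _ (inl (ivl_pred j)) (bq_d h)) else None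
  | Ka, inr j =>
      if (j == (ivl_pred j).+1 :> nat) =P true is ReflectT h
      then Some (existT _ (inr (ivl_pred j)) (bq_a h)) else None
  | _, _ => None
  end.

Lemma bout_arrow x y (a : barrow x y) : bout (akind a) x = Some (existT _ y a).
Proof.
have pred_eq c d (j i : ivl c d) (h : j == i.+1 :> nat) : i = ivl_pred j.
  by apply: val_inj; rewrite /= ivl_predE; have := numP i; lia.
case: a => [j i h|j i h|j i h|j] //=.
- have e := pred_eq _ _ _ _ h; move: e h => -> h; case: eqP => // h'.
  by rewrite (bool_irrelevance h h').
- have e := pred_eq _ _ _ _ h; move: e h => -> h; case: eqP => // h'.
  by rewrite (bool_irrelevance h h').
have e : i = bdown j by apply: val_inj; rewrite /= (eqP h).
by move: e h => -> h; rewrite (bool_irrelevance h (bdownP j)).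
Qed.

Lemma bout_kind K x z : bout K x = Some z -> akind (projT2 z) = K.
Proof.
by case: K x z => [] [] j z //=; do ?[case: eqP => // h]; case=> <-.
Qed.

(** Summing all arrows of a kind turns the relations into identities between four elements, free of
    vertex indices. *)
Definition bX (K : bkind) : B :=
  \sum_x (if bout K x is Some z then bcls (parrow (projT2 z)) else 0).

Lemma X_bcls K x y (p : qpath barrow x y) :
  bX K * bcls p = if bout K y is Some z then bcls (pcons (projT2 z) p) else 0.
Proof.
rewrite /bX mulr_suml (bigD1 y) //= big1 ?addr0 => [|z zy].
  by case: bout => [z|]; rewrite ?mul0r // bcls_cat.
case: bout => [t|]; rewrite ?mul0r // bcls_mul0 //.
by move=> e; rewrite e eqxx in zy.
Qed.

Lemma bcls_pcons x y z (a : barrow y z) (p : qpath barrow x y) :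
  bcls (pcons a p) = bX (akind a) * bcls p.
Proof. by rewrite X_bcls bout_arrow. Qed.

Lemma X_bE K x :
  bX K * bE x = if bout K x is Some z then bcls (parrow (projT2 z)) else 0.
Proof. exact: X_bcls. Qed.

Lemma brel r : bq_relation r -> iquot_pi (@bq_relation k n) r = 0.
Proof.
move=> h; rewrite -(raddf0 (iquot_pi (@bq_relation k n))).
by apply/iquot_piP; rewrite subr0; apply/asboolP => J _; apply.
Qed.

(** The total form of e_* in t^2 = e_*, because t exists on the top row only. *)
Definition btop : B := \sum_(j : ivl 2 n) bE (inl j).

Lemma btop_bcls x y (p : qpath barrow x y) :
  btop * bcls p = if y is inl _ then bcls p else 0.
Proof.
rewrite /btop mulr_suml; case: y p => j p.
  rewrite (bigD1 j) //= bE_bcls big1 ?addr0 // => i ij.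
  by rewrite bcls_mul0 // => -[e]; rewrite e eqxx in ij.
by rewrite big1 // => i _; rewrite bcls_mul0.
Qed.

Lemma btop_bE x : btop * bE x = if x is inl _ then bE x else 0.
Proof. exact: btop_bcls. Qed.

Ltac X_simp := rewrite -?mulrA ?(X_bE, btop_bE, mulr0) /=;
  rewrite ?(X_bcls, btop_bcls, mulr0) /=;
  do ?[let h := fresh "h" in case: eqP => h;
    [have ? := (h : is_true _)|have ? := introN idP h] => //=;
    rewrite ?(X_bcls, btop_bcls, mulr0) /=].

Lemma XTT : bX Kt * bX Kt = btop.
Proof.
apply: bE_ext => -[] j; X_simp => //.
apply/eqP; rewrite -subr_eq0 -raddfB; apply/eqP.
by have := brel (bq_tt k j); rewrite basis_cat.
Qed.

Lemma btopT : btop * bX Kt = bX Kt. Proof. by apply: bE_ext => -[] j; X_simp. Qed.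
Lemma btopD : btop * bX Kd = bX Kd. Proof. by apply: bE_ext => -[] j; X_simp. Qed.
Lemma Tbtop : bX Kt * btop = bX Kt. Proof. by apply: bE_ext => -[] j; X_simp. Qed.
Lemma Dbtop : bX Kd * btop = bX Kd. Proof. by apply: bE_ext => -[] j; X_simp. Qed.
Lemma Cbtop : bX Kc * btop = bX Kc. Proof. by apply: bE_ext => -[] j; X_simp. Qed.
Lemma btopA : btop * bX Ka = 0.
Proof. by apply: bE_ext => -[] j; X_simp; rewrite mul0r. Qed.
Lemma btopC : btop * bX Kc = 0.
Proof. by apply: bE_ext => -[] j; X_simp; rewrite mul0r. Qed.
Lemma Abtop : bX Ka * btop = 0.
Proof. by apply: bE_ext => -[] j; X_simp; rewrite mul0r. Qed.

Lemma XTDT : bX Kt * bX Kd * bX Kt = bX Kd.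
Proof.
apply: bE_ext => -[] j; X_simp => //.
apply/eqP; rewrite -subr_eq0 -raddfB; apply/eqP.
by have := brel (bq_tdt k h); rewrite !basis_cat.
Qed.

Lemma XDD : bX Kd * bX Kd = 0.
Proof.
apply: bE_ext => -[] j; X_simp; rewrite ?mul0r //.
by have := brel (bq_dd k h h0); rewrite !basis_cat.
Qed.

Lemma XAA : bX Ka * bX Ka = 0.
Proof.
apply: bE_ext => -[] j; X_simp; rewrite ?mul0r //.
by have := brel (bq_aa k h h0); rewrite !basis_cat.
Qed.

Lemma XCDA : (bX Kc - bX Kc * bX Kt) * bX Kd = bX Ka * (bX Kc - bX Kc * bX Kt).
Proof.
apply: bE_ext => -[] j; last by rewrite !(mulrBl, mulrBr); X_simp; rewrite !subr0.
(* At j = 2 no d leaves j and no a leaves 1', so both sides vanish. *)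
have jb := numP j; case: (leqP 3 j) => j3; last first.
  have Ep := ivl_predE j; have Ep' := ivl_predE (bdown j).
  rewrite !(mulrBl, mulrBr); X_simp; rewrite ?mulr0 ?subr0 //;
    by exfalso; move: Ep'; rewrite /=; lia.
pose i := ivl_pred j.
have iE : i = (j - (2 < j))%N :> nat := ivl_predE j.
have ji : j == i.+1 :> nat by lia.
have ji' : bdown j == (bdown i).+1 :> nat by rewrite /=; lia.
have := brel (bq_cda k ji (bdownP i) (bdownP j) ji').
rewrite !(mulrBl, mulrBr) !basis_cat /= raddfB /= => /subr0_eq.
rewrite !raddfB /= -!/(bcls _) /parrow !bcls_pcons /= => e.
by rewrite -!mulrA.
Qed.

Lemma XTD : bX Kt * bX Kd = bX Kd * bX Kt.
Proof. by rewrite -[in RHS]XTDT -!mulrA XTT Dbtop. Qed.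

Definition bK : B := bX Ka * bX Kc - bX Kc * bX Kd.

Lemma bKT : bK * bX Kt = bK.
Proof. exact: (commuting_relation _ _ XTD).1 XCDA. Qed.

(** The word act is not a value of [theta] on a single normal path; here it becomes a combination of
    such values. *)
Lemma bACT : bX Ka * bX Kc * bX Kt =
  bX Ka * bX Kc - bX Kc * bX Kd + bX Kc * bX Kt * bX Kd.
Proof.
have := bKT; rewrite /bK mulrBl => /eqP; rewrite subr_eq => /eqP ->.
by rewrite -!mulrA XTD.
Qed.

Lemma bACTD : bX Ka * bX Kc * bX Kt * bX Kd = bX Ka * bX Kc * bX Kd.
Proof.
by rewrite bACT mulrDl mulrBl -!mulrA XDD !mulr0 subr0 addr0.
Qed.

End BoundQuiverAlgebra.

(** * Comparison of the two algebras *)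

Section Comparison.
Variables (k : comNzRingType) (F : fieldType) (n : nat).
Local Notation gv := (gam_vert n).
Local Notation bv := (bq_vert n).
Local Notation A := (kD1 k F n).
Local Notation B := (kBQ k n).
Local Notation one := (one k F (n := n)).
Local Notation oval := (oval k F).
Local Notation ide := (ide k F n).
Local Notation bX := (bX k n).
Local Notation bE := (bE k (n := n)).
Local Notation eU := (eU k F n).
Local Notation eT := (eT k F n).
Local Notation eP1 := (eP1 k F n).
Local Notation eP2 := (eP2 k F n).
Local Notation eP3 := (eP3 k F n).
Local Notation eC := (eC k F n).

Fact gx_subproof1 (j : ivl 2 n) : (3 <= j.+1 <= n.+1)%N.
Proof. by have := numP j; lia. Qed.
Fact gx_subproof2 (j : ivl 1 n.-1) : (2 <= j.+1 <= n)%N.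
Proof. by have := numP j; lia. Qed.
Fact bx_subproof1 (m : ivl 3 n.+1) : (2 <= m.-1 <= n)%N.
Proof. by have := numP m; lia. Qed.
Fact bx_subproof2 (m : ivl 2 n) : (1 <= m.-1 <= n.-1)%N.
Proof. by have := numP m; lia. Qed.

Definition gx (x : bv) : gv :=
  match x with
  | inl j => inl (Ivl (gx_subproof1 j))
  | inr j => inr (Ivl (gx_subproof2 j))
  end.

Definition bx (v : gv) : bv :=
  match v with
  | inl m => inl (Ivl (bx_subproof1 m))
  | inr m => inr (Ivl (bx_subproof2 m))
  end.

Lemma gxK : cancel gx bx.
Proof. by case=> j; [congr (inl _)|congr (inr _)]; apply: val_inj. Qed.

Lemma bxK : cancel bx gx.
Proof.
by case=> m; [congr (inl _)|congr (inr _)]; apply: val_inj => /=; have := numP m; lia.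
Qed.

Definition kop (K : bkind) : operator n :=
  match K with Kd => opP3 n | Ka => opP1 n | Kc => opP2 n | Kt => opT n end.

Definition kpre (K : bkind) : A :=
  match K with Kd => -1 | Ka => 1 | Kc => 1 - eU 2 | Kt => 1 end.

(* [pi_3] gets a sign, so that [(c - ct)d = a(c - ct)] holds without one. *)
Definition kval (K : bkind) : A :=
  match K with
  | Kd => - (eP3 * ide) | Ka => eP1 * ide | Kc => eC | Kt => eT * ide
  end.

Lemma kvalE K : kval K = kpre K * (oval (kop K) * ide).
Proof. by case: K; rewrite /= ?mul1r ?mulN1r. Qed.

Lemma kop_bout K x :
  if bout K x is Some z
  then odom (kop K) (gx x) /\ otgt (kop K) (gx x) = gx (projT1 z)
  else odom (kop K) (gx x) = false.
Proof.
case: K x => [] [] j //=.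
- have := ivl_predE j; case: eqP => [h|h] /= pj; last by have := numP j; lia.
  split; first by have := numP (ivl_pred j); lia.
  congr (inl _); apply: val_inj; rewrite /= val_insubd /=.
  by have := numP j; have := numP (ivl_pred j); case: ifP; lia.
- have := ivl_predE j; case: eqP => [h|h] /= pj; last by have := numP j; lia.
  split; first by have := numP (ivl_pred j); lia.
  congr (inr _); apply: val_inj; rewrite /= val_insubd /=.
  by have := numP j; have := numP (ivl_pred j); case: ifP; lia.
- split=> //; congr (inr _); apply: val_inj => /=.
  by have := numP j; lia.
Qed.

Lemma one_kpre K v : one v * kpre K = kpre K * one v.
Proof.
case: K; rewrite /= ?mulr1 ?mul1r //; first by rewrite mulrN1 mulN1r.
by rewrite mulrBl mulrBr mul1r mulr1 one_eU.
Qed.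

Lemma ide_kval K : ide * kval K = kval K.
Proof.
case: K => /=; [by rewrite mulrN ideP3|exact: ideP1|exact: ide_eC|].
by rewrite mulrA ideT -mulrA ide_idem.
Qed.

Lemma kval_ide K : kval K * ide = kval K.
Proof. by rewrite kvalE -!mulrA ide_idem. Qed.

Lemma kval_one K x z : bout K x = Some z ->
  one (gx (projT1 z)) * (kval K * one (gx x)) = kval K * one (gx x).
Proof.
move=> bz; have := kop_bout K x; rewrite bz => -[_ <-].
rewrite kvalE -!mulrA ide_one mulrA one_kpre -!mulrA; congr (_ * _).
by rewrite !mulrA -(mulrA (one _)) one_oval_one.
Qed.

Lemma kval_one0 K x : bout K x = None -> kval K * one (gx x) = 0.
Proof.
move=> bz; have := kop_bout K x; rewrite bz => od.
by rewrite kvalE -!mulrA ide_one (mulrA (oval _)) oval_one od mul0r mulr0.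
Qed.

Definition beps (x : bv) : A := one (gx x) * ide.

Definition balpha (x y : bv) (a : bq_arrow x y) : A :=
  kval (akind a) * one (gx x).

Lemma bepsM x y : beps x * beps y = if x == y then beps x else 0.
Proof.
rewrite /beps mulrA -(mulrA (one _)) ide_one mulrA oneM (can_eq gxK).
by case: eqP => _; rewrite ?mul0r // -mulrA ide_idem.
Qed.

Lemma balphaE x y (a : bq_arrow x y) : beps y * balpha a * beps x = balpha a.
Proof.
rewrite /beps /balpha -!mulrA (mulrA (one (gx x))) oneM eqxx -ide_one.
rewrite (mulrA (kval _)) kval_ide (mulrA ide) ide_kval.
exact: (kval_one (bout_arrow a)).
Qed.

Lemma path_val_cons x y z (a : bq_arrow y z) (p : qpath (@bq_arrow n) x y) :
  path_val beps balpha (pcons a p) = kval (akind a) * path_val beps balpha p.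
Proof.
have one_beps : one (gx y) * beps y = beps y by rewrite mulrA oneM eqxx.
by rewrite /= -(path_val_epsl bepsM balphaE p) -mulrA (mulrA (one _)) one_beps.
Qed.

Lemma path_val_nil x :
  path_val beps balpha (@pnil _ (@bq_arrow n) x) = one (gx x) * ide.
Proof. by []. Qed.

Lemma ide_beps v : ide * (one v * ide) = one v * ide.
Proof. by rewrite mulrA ide_one -mulrA ide_idem. Qed.

Lemma kvalTT v : isD v -> kval Kt * (kval Kt * (one v * ide)) = one v * ide.
Proof.
move=> Dv /=; rewrite -!mulrA ide_beps (mulrA ide) ideT -!mulrA ide_beps.
by rewrite (mulrA eT (one v)) (mulrA eT (eT * _)) eTT.
Qed.

Lemma eTTP3 : eT * (eT * eP3) = eP3.
Proof.
apply: one_ext => v; rewrite -!mulrA -(one_oval_one k F (opP3 n)).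
case Dv: (isD v); last by rewrite oval_one /= Dv !mulr0.
by rewrite !mulrA -(mulrA eT) eTT ?isD_pred // Dv.
Qed.

Lemma kvalTD : kval Kt * kval Kd = kval Kd * kval Kt.
Proof.
have e : eT * ide * (eP3 * ide) = eP3 * ide * (eT * ide).
  rewrite -!mulrA ideP3 (mulrA ide) ideT -mulrA ide_idem.
  by rewrite !mulrA eTP3.
by rewrite /= mulrN mulNr e.
Qed.

Lemma kvalTDT : kval Kt * kval Kd * kval Kt = kval Kd.
Proof.
have e : eT * ide * (eT * ide * (eP3 * ide)) = eP3 * ide.
  rewrite -!mulrA ideP3 (mulrA ide) ideT -!mulrA ideP3.
  by rewrite (mulrA eT eP3) (mulrA eT (eT * _)) eTTP3.
by rewrite -mulrA -kvalTD /= !mulrN e.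
Qed.

Lemma kvalDD : kval Kd * kval Kd = 0.
Proof. by rewrite /= mulrNN eP3P3_ide. Qed.

Lemma kvalAA : kval Ka * kval Ka = 0.
Proof. exact: eP1P1_ide. Qed.

Lemma kvalACD : kval Ka * kval Kc - kval Kc * kval Kd = eP1 * eP2 * ide.
Proof. by rewrite /= mulrN opprK eP1P2_ide. Qed.

Lemma kvalACDT : (kval Ka * kval Kc - kval Kc * kval Kd) * kval Kt =
  kval Ka * kval Kc - kval Kc * kval Kd.
Proof.
by rewrite kvalACD /= -(mulrA _ ide) (mulrA ide) ideT -mulrA ide_idem mulrA eP1P2T.
Qed.

Lemma kvalCDA : (kval Kc - kval Kc * kval Kt) * kval Kd =
  kval Ka * (kval Kc - kval Kc * kval Kt).
Proof. exact: (commuting_relation _ _ kvalTD).2 kvalACDT. Qed.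

Local Notation plin := (path_lin (B := A) (fun p => path_val beps balpha (tpth p))).

Lemma bq_relation_path_val r : bq_relation r -> plin r = 0.
Proof.
have cda_expand (R : pzRingType) (a c d t e : R) :
    (c - c * t) * d = a * (c - c * t) ->
    c * (d * e) - c * (t * (d * e)) + (- (a * (c * e)) - - (a * (c * (t * e)))) = 0.
  move=> /(congr1 (fun z => z * e)); rewrite !(mulrBl, mulrBr) -!mulrA => ->.
  by rewrite -opprD subrr.
have plB x y (p : qpath (@bq_arrow n) x y) :
    plin (basis k p) = path_val beps balpha p by apply: path_lin_basis.
have pc x y z (a : bq_arrow y z) (p : qpath (@bq_arrow n) x y) :
  pcat (parrow a) p = pcons a p by [].
have pcc x y z t (a : bq_arrow y z) (q : qpath (@bq_arrow n) t y)
    (p : qpath (@bq_arrow n) x t) : pcat (pcons a q) p = pcons a (pcat q p) by [].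
case=> [j|j i ji|j i j' i' ji ii' jj' ji'|l j i lj ji|l j i lj ji].
- rewrite raddfB /= basis_cat !plB pc !path_val_cons path_val_nil /akind.
  by rewrite kvalTT ?subrr.
- rewrite raddfB /= !basis_cat !plB !(pc, pcc) !path_val_cons !path_val_nil.
  have := kvalTDT; rewrite -mulrA /akind => e.
  by rewrite (mulrA (kval Kd)) (mulrA (kval Kt)) e subrr.
- rewrite !(mulrBl, mulrBr) !basis_cat !raddfB /= !plB.
  rewrite !path_val_cons !path_val_nil /akind.
  exact: (cda_expand A _ _ _ _ (one (gx (inl j)) * ide) kvalCDA).
- rewrite basis_cat plB pc !path_val_cons path_val_nil /akind mulrA.
  by rewrite kvalDD mul0r.
- rewrite basis_cat plB pc !path_val_cons path_val_nil /akind mulrA.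
  by rewrite kvalAA mul0r.
Qed.

Lemma gx_bij : {on predT, bijective gx}.
Proof. by apply: onW_bij; exists bx; [exact: gxK|exact: bxK]. Qed.

Lemma sum_one_gx : \sum_x one (gx x) = 1 :> A.
Proof. by rewrite -(sum_one k F n) [RHS](reindex gx gx_bij). Qed.

Lemma quiver_hom_kD1 : exists psi : {additive B -> A},
  [/\ {morph psi : x y / x * y},
      forall c x, psi (alg_map B c * x) = alg_map A c * psi x,
      psi 1 = ide,
      forall x, psi (bE x) = one (gx x) * ide &
      forall K, psi (bX K) = kval K].
Proof.
have [psi [pM pZ p1 pB]] := quiver_hom bepsM balphaE bq_relation_path_val.
exists psi; split=> // [|x|K].
- by rewrite p1 -mulr_suml sum_one_gx mul1r.
- exact: pB.
- rewrite raddf_sum -[RHS]mulr1 -sum_one_gx mulr_sumr; apply: eq_bigr => x _.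
  case bz: (bout K x) => [z|]; last by rewrite raddf0 kval_one0.
  rewrite pB path_val_cons path_val_nil (bout_kind bz).
  by rewrite -ide_one mulrA kval_ide.
Qed.

End Comparison.

(** * The retraction onto the bound quiver algebra *)

Section Retraction.
Variables (k : comNzRingType) (F : fieldType) (n : nat).
Local Notation gv := (gam_vert n).
Local Notation gpath := (qpath (@gam_arrow n)).
Local Notation A := (kD1 k F n).
Local Notation B := (kBQ k n).
Local Notation cls := (cls k F (n := n)).
Local Notation cl := (cl k F (n := n)).
Local Notation ide := (ide k F n).
Local Notation bX := (bX k n).
Local Notation bE := (bE k (n := n)).
Local Notation eU := (eU k F n).

Fixpoint bword (ws : seq bkind) : B :=
  if ws is K :: ws' then bX K * bword ws' else 1.

Definition oword (ws : seq bkind) : seq (operator n) := map (@kop n) ws.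

Lemma bX_target K v : bX K * bE (bx v) =
  if odom (kop n K) v then bE (bx (otgt (kop n K) v)) * (bX K * bE (bx v)) else 0.
Proof.
have := kop_bout K (bx v); rewrite bxK X_bE; case: bout => [z [-> ->]|->] //=.
by rewrite gxK bE_bcls.
Qed.

Lemma bword_target ws v : bword ws * bE (bx v) =
  if wdom (oword ws) v
  then bE (bx (wtgt (oword ws) v)) * (bword ws * bE (bx v)) else 0.
Proof.
elim: ws => [|K ws IH] /=; first by rewrite mul1r bEM eqxx.
rewrite -mulrA; case: (boolP (wdom _ v)) IH => /= _ IH; last by rewrite IH mulr0.
have := bX_target K (wtgt (oword ws) v); rewrite IH.
by case: ifP => _ e; [apply: mul_target|apply: mul0_left].
Qed.

Lemma bword_sandwich ws v w : bE (bx w) * (bword ws * bE (bx v)) =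
  if wdom (oword ws) v && (wtgt (oword ws) v == w) then bword ws * bE (bx v) else 0.
Proof.
rewrite {1}bword_target; case: (boolP (wdom _ v)) => /= dv; last by rewrite mulr0.
rewrite mulrA bEM (can_eq (bxK (n := n))) eq_sym.
case: eqP => [<-|_]; last by rewrite mul0r.
by rewrite [RHS]bword_target dv.
Qed.

(* A path that is not normal factors through some [iota_(i-1) pi_i] at its source
   or at its target, and is killed by the projector. *)
Definition normal (v w : gv) (f : nat -> nat) : Prop :=
  (forall i, gbase w < i < gsize w -> f i <> f i.-1)%N /\
  (forall i, gbase v < i < gsize v -> exists x, (1 <= x <= gsize w)%N /\ f x = i)%N.

(* Each sum lists the values of all lengths; between [v] and [w] only the terms of
   the right length survive. *)
Definition normal_sum (v w : gv) (f : nat -> nat) : B :=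
  if isD w then
    if (f 1 == 2)%N then bword [:: Kt] - bword [:: Kt; Kd]
    else bword [::] - bword [:: Kd]
  else if isD v then
    if (f 1 == 1)%N then bword [:: Kc] - bword [:: Kc; Kd]
    else if (f 1 == 2)%N then bword [:: Kc; Kt] - bword [:: Kc; Kt; Kd]
    else bword [:: Ka; Kc] - bword [:: Kc; Kd] - bword [:: Ka; Kc; Kd]
  else bword [::] + bword [:: Ka].

Definition theta_path (v w : gv) (f : nat -> nat) : B :=
  if `[< normal v w f >] then bE (bx w) * (normal_sum v w f * bE (bx v)) else 0.

Lemma normal_ext v w f g :
  (forall x, 1 <= x <= gsize w -> f x = g x)%N -> normal v w f -> normal v w g.
Proof.
move=> fg [fi fs]; split=> i ib.
  by have := fi i ib; rewrite !fg; case: w ib {fg fi fs} => w /=; lia.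
by have [x [xb <-]] := fs i ib; exists x; rewrite fg.
Qed.

Lemma theta_path_ext v w f g :
  (forall x, 1 <= x <= gsize w -> f x = g x)%N -> theta_path v w f = theta_path v w g.
Proof.
move=> fg; rewrite /theta_path.
have -> : `[< normal v w f >] = `[< normal v w g >].
  by apply/asboolP/asboolP; apply: normal_ext => x xb; rewrite fg.
by rewrite /normal_sum fg //; case: w {fg} => w /=; have := numP w; lia.
Qed.

Local Notation rel := (@gam_relation k F n).
Local Notation P := (path_algebra k (@gam_arrow n)).
Let tlin : {additive P -> B} :=
  path_lin (fun p => theta_path (tsrc p) (ttgt p) (path_fun (tpth p))).

Let tlin_basis v w (p : gpath v w) : tlin (basis k p) = theta_path v w (path_fun p).
Proof. by rewrite /tlin /= path_lin_basis. Qed.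

Let tlinZ c x : tlin (alg_map P c * x) = alg_map B c * tlin x.
Proof. by rewrite /tlin /= path_linZ. Qed.

Lemma tlin_rel a b r : rel r -> tlin (a * r * b) = 0.
Proof.
case=> v w p1 p2 /nat_iso_evalP e12.
elim/path_algebra_ind: a => [|x y Sx Sy|c x Sx|w1 w2 q].
- by rewrite !mul0r raddf0.
- by rewrite !mulrDl raddfD Sx Sy addr0.
- by rewrite -!mulrA tlinZ !mulrA Sx mulr0.
elim/path_algebra_ind: b => [|x y Sx Sy|c x Sx|v1 v2 s].
- by rewrite !mulr0 raddf0.
- by rewrite mulrDr raddfD Sx Sy addr0.
- by rewrite mulrA -alg_central -mulrA tlinZ Sx mulr0.
rewrite mulrBr mulrBl raddfB; case: (eqVneq w w1) => [e|/eqP ne]; last first.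
  by rewrite !(basis_mul0 k) ?mul0r ?subrr.
case: _ / e q => q; rewrite !basis_cat.
case: (eqVneq v2 v) => [e|/eqP ne]; last by rewrite !(basis_mul0 k) ?subrr.
case: _ / e p1 p2 e12 => p1 p2 e12; rewrite !basis_cat !tlin_basis.
apply/eqP; rewrite subr_eq0; apply/eqP; apply: theta_path_ext => x xb.
by rewrite !path_fun_cat /= e12 // path_fun_range.
Qed.

Definition theta : A -> B := descent (R := rel) tlin.

Lemma theta_zmod : zmod_morphism theta.
Proof. exact: (descent_zmod tlin_rel). Qed.
HB.instance Definition _ := GRing.isZmodMorphism.Build A B theta theta_zmod.

Lemma thetaZ c x : theta (alg_map A c * x) = alg_map B c * theta x.
Proof.
rewrite -[x]iquot_repr -[alg_map A c]/(iquot_pi rel (alg_map P c)).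
by rewrite -(rmorphM (iquot_pi rel)) /theta !(descent_pi tlin_rel) tlinZ.
Qed.

Lemma theta_cls v w (p : gpath v w) : theta (cls p) = theta_path v w (path_fun p).
Proof. by rewrite /theta /cls (descent_pi tlin_rel) tlin_basis. Qed.

Lemma theta_cl v w f : realizable v w f -> theta (cl v w f) = theta_path v w f.
Proof.
move=> [p pf]; rewrite (cl_cls k F pf) theta_cls.
exact: theta_path_ext.
Qed.

Lemma configuration_ind (S : A -> Prop) :
  S 0 -> (forall x y, S x -> S y -> S (x + y)) ->
  (forall c x, S x -> S (alg_map A c * x)) ->
  (forall v w (p : gpath v w), S (cls p)) -> forall x, S x.
Proof.
move=> S0 SD SZ Sp x; rewrite -[x]iquot_repr.
elim/path_algebra_ind: (repr _) => [|y z Sy Sz|c y Sy|v w p].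
- by rewrite raddf0.
- by rewrite raddfD; apply: SD.
- by rewrite rmorphM; apply: SZ.
exact: Sp.
Qed.

(** On the left, [nu i] makes the values at i and i - 1 equal, against the first clause of [normal];
    on the right it makes the map miss i, against the second. *)
Lemma theta_eU i x : theta (eU i * x) = 0.
Proof.
elim/configuration_ind: x => [|x y Sx Sy|c x Sx|v w p].
- by rewrite mulr0 raddf0.
- by rewrite mulrDr (raddfD theta) /= Sx Sy addr0.
- by rewrite mulrA -alg_central -mulrA thetaZ Sx mulr0.
have rp : realizable v w (path_fun p) by exists p.
rewrite cls_cl oval_cl //; case: ifP => [/= iw|_]; last by rewrite raddf0.
rewrite theta_cl; last exact: realizable_comp rp (oP (o := opU n i) iw).
rewrite /theta_path; case: asboolP => // -[/(_ i iw) []] /=.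
by rewrite /nu; congr (path_fun p _); lia.
Qed.

Lemma theta_eUr i x : theta (x * eU i) = 0.
Proof.
elim/configuration_ind: x => [|x y Sx Sy|c x Sx|v w p].
- by rewrite mul0r raddf0.
- by rewrite mulrDl (raddfD theta) /= Sx Sy addr0.
- by rewrite -mulrA thetaZ Sx mulr0.
have rp : realizable v w (path_fun p) by exists p.
rewrite -(cls_one k F p) -mulrA one_eU oval_one /=.
case: ifP => [iw|_]; last by rewrite mulr0 raddf0.
rewrite cls_cl clM //; last exact: (oP (o := opU n i) iw).
rewrite theta_cl; last exact: realizable_comp (oP (o := opU n i) iw) rp.
rewrite /theta_path; case: asboolP => // -[_ /(_ i iw) [x [_]]] /=.
by rewrite /nu; lia.
Qed.

Lemma theta_ide x : theta (ide * x) = theta x.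
Proof. exact: (additive_nidem _ _ _ theta_eU). Qed.

Lemma theta_ider x : theta (x * ide) = theta x.
Proof. by apply: additive_nidemr => j y; apply: theta_eUr. Qed.

End Retraction.

(** A gap would skip a value between c and m. The two possible starts c and c + 1 later separate a
    word from the same word with one more contraction. *)
Lemma surjective_increasing_shift (f : nat -> nat) (b q c m : nat) :
  (b <= q)%N -> (c <= f b)%N -> f q = m ->
  (forall x, (b <= x < q)%N -> (f x < f x.+1)%N) ->
  (forall i, (c < i < m)%N -> exists x, (b <= x <= q)%N /\ f x = i) ->
  (f b <= c.+1)%N /\ (forall x, (b <= x <= q)%N -> f x = (f b + (x - b))%N).
Proof.
move=> bq cf fq f_lt f_surj.
have f_le x y : (b <= x)%N -> (x <= y <= q)%N -> (f x <= f y)%N.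
  move=> bx; elim: y => [|y IH] xy; first by have -> : x = 0%N by lia.
  case: (eqVneq x y.+1) => [->//|ne].
  by apply: leq_trans (IH _) (ltnW (f_lt y _)); lia.
split.
  rewrite leqNgt; apply/negP => cb; have := f_le b q; rewrite fq => fbm.
  have [|x [xb fx]] := f_surj c.+1; first by lia.
  by have := f_le b x; lia.
elim=> [|x IH] xb; first by rewrite sub0n addn0; congr f; lia.
case: (eqVneq b x.+1) => [<-|ne]; first by rewrite subnn addn0.
have fx : f x = (f b + (x - b))%N by apply: IH; lia.
suff : f x.+1 = (f x).+1 by lia.
have fx1 := f_lt x; apply/eqP; rewrite eqn_leq fx1 ?andbT; last by lia.
rewrite leqNgt; apply/negP => gap.
have xq := f_le x.+1 q; have bx := f_le b x.
have [|y [yb fy]] := f_surj (f x).+1; first by lia.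
by case: (leqP y x) => yx; [have := f_le y x | have := f_le x.+1 y]; lia.
Qed.

(** * Invariants of vertex maps *)

Section PathInvariants.
Variable n : nat.
Local Notation gv := (gam_vert n).

(* The reachability order on vertices; [1] and [2] are incomparable in [D_m]. *)
Definition vle (v : gv) (x y : nat) : bool :=
  (x == y) || (x < y)%N && (isD v ==> (3 <= y)%N).

(** These properties hold for generators and compose. Only a sink goes to a sink, because no pi_i
    deletes one and the bound i <= m - 2 keeps iota_i from duplicating one. *)
Definition vmap (v w : gv) (f : nat -> nat) : Prop :=
  [/\ forall x y, (1 <= x <= gsize w)%N -> (1 <= y <= gsize w)%N ->
        vle w x y -> vle v (f x) (f y),
      isD w -> isD v /\ ((f 1, f 2) = (1, 2) \/ (f 1, f 2) = (2, 1))%N,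
      f (gsize w) = gsize v &
      forall x, (1 <= x < gsize w)%N -> (1 <= f x < gsize v)%N].

Lemma arrow_vmap v w (a : gam_arrow v w) : vmap v w (arrow_fun a).
Proof.
case: a => [m|m p i mp im|m p i mp im|m p i mp im|m p i mp im|m p i mp im];
  have := numP m; try have := numP p;
  rewrite /vmap /vle /= ?/bump ?/unbump => pb; try (move=> mb);
  (split=> [x y|||x]; rewrite ?swap12E ?implybT //; try lia);
  by split=> //; first [left; congr (_, _); lia|right; congr (_, _); lia].
Qed.

Lemma path_vmap v w (p : qpath (@gam_arrow n) v w) : vmap v w (path_fun p).
Proof.
elim: p => [|u z a p [pm pD pt pb]].
  split=> //; first by move=> Dv; split=> //; left.
have [am aD atop ab] := arrow_vmap a; split=> /= [x y xb yb xy|/aD [Du a12]||x xb].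
- by apply: pm (am _ _ xb yb xy); apply: arrow_fun_range.
- have [-> p12] := pD Du; split=> //.
  by case: a12 => -[-> ->]; case: p12 => -[-> ->]; [left|right|right|left].
- by rewrite atop.
exact/pb/ab.
Qed.

End PathInvariants.

(** * Normal paths as words *)

Section Correspondence.
Variables (k : comNzRingType) (F : fieldType) (n : nat).
Local Notation B := (kBQ k n).
Local Notation one := (one k F (n := n)).
Local Notation cl := (cl k F (n := n)).
Local Notation bw := (bword k n).
Local Notation ow := (oword n).
Local Notation wv ws := (wval k F (ow ws)).
Local Notation theta := (theta (k := k) (F := F) (n := n)).

(* Normal paths, written as words in [pi_1], [pi_2], [pi_3] and [t], with their
   images under [theta]. *)
Inductive theta_image : seq bkind -> B -> Prop :=
| image_1 : theta_image [::] (bw [::])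
| image_t : theta_image [:: Kt] (bw [:: Kt])
| image_d : theta_image [:: Kd] (- bw [:: Kd])
| image_td : theta_image [:: Kt; Kd] (- bw [:: Kt; Kd])
| image_a : theta_image [:: Ka] (bw [:: Ka])
| image_c : theta_image [:: Kc] (bw [:: Kc])
| image_ct : theta_image [:: Kc; Kt] (bw [:: Kc; Kt])
| image_cd : theta_image [:: Kc; Kd] (- bw [:: Kc; Kd])
| image_ctd : theta_image [:: Kc; Kt; Kd] (- bw [:: Kc; Kt; Kd])
| image_ac : theta_image [:: Ka; Kc] (bw [:: Ka; Kc] - bw [:: Kc; Kd])
| image_acd : theta_image [:: Ka; Kc; Kd] (- bw [:: Ka; Kc; Kd]).

Let gsz := (isD_pred, isD_toA, gsize_pred, gsize_toA, gbaseE).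

Local Open Scope nat_scope.

(** Apart from its values at 1 and 2, a normal map is a shift with two possible starts. This gives
    twelve cases, the identities of D_m and A_m sharing the empty word. *)
Lemma normal_word v w f : realizable v w f -> normal v w f ->
  exists ws b, theta_image ws b /\ cl v w f = (wv ws * one v)%R.
Proof.
move=> [p pf] /(normal_ext (g := path_fun p)) [x xb|]; first by rewrite pf.
rewrite (cl_cls k F pf) cls_cl => {pf f} .
have [pm pD pt pb] := path_vmap p; move: (path_fun p) pm pD pt pb => {p} f pm pD pt pb.
have vb := gsize_bounds v; have wb := gsize_bounds w; rewrite !gbaseE => f_neq f_surj.
have word ws b : theta_image ws b -> wdom (ow ws) v ->
    isD (wtgt (ow ws) v) = isD w -> gsize (wtgt (ow ws) v) = gsize w ->
    (forall x, 1 <= x <= gsize w -> f x = wfun (ow ws) x) ->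
    exists ws b, theta_image ws b /\ cl v w f = (wv ws * one v)%R.
  move=> c dv eD eS ef; exists ws, b; split=> //.
  by rewrite wval_one dv (gam_vert_eq eD eS); apply: cl_ext.
(* Normality makes the monotone map strict at interior vertices; at the last step strictness holds
   because only the sink goes to the sink. *)
have step x : (gbase w <= x < gsize w) -> (f x < f x.+1) /\ (isD v -> 3 <= f x.+1).
  rewrite gbaseE => xb.
  case: (eqVneq x.+1 (gsize w)) => [e|ne].
    by rewrite e pt; have := pb x; case: (isD v) vb; case: (isD w) xb; lia.
  have := pm x x.+1; have := f_neq x.+1 => /=; rewrite /vle.
  by move: (f x) (f x.+1) => y z; case: (isD v); case: (isD w) xb => /=; lia.
(* Vertices below b take values at most c, so all values above c are attained from b on. *)
have shift b c : (b <= gsize w) -> (c <= f b) -> (gbase w <= b) ->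
    (forall i, c < i < gsize v -> exists x, (1 <= x <= gsize w) /\ f x = i) ->
    (forall x, 1 <= x < b -> f x <= c) ->
    (f b <= c.+1) /\ (forall x, (b <= x <= gsize w) -> f x = (f b + (x - b))).
  move=> bw cf wb' sj lo.
  apply: (surjective_increasing_shift (m := gsize v)) => // [x xb|i ib].
    by case: (step x) => //; lia.
  have [x [xb fx]] := sj i ib; exists x; split=> //.
  by have := lo x; lia.
case Dw: (isD w) pD vb wb f_surj shift => pD vb wb f_surj shift.
  have [Dv f12] := pD isT; rewrite Dv in vb f_surj word.
  have f3 : (3 <= f 3).
    have := pm 1 3; have := pm 2 3; rewrite /vle Dv Dw /=.
    by case: f12 => -[-> ->]; move: (f 3) => z; lia.
  have [f34 fx] : (f 3 <= 4) /\
      forall x, (3 <= x <= gsize w) -> f x = (f 3 + (x - 3)).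
    apply: shift; rewrite ?gbaseE ?Dw //; first by lia.
    by case: f12 => -[f1 f2]; case=> [|[|[|x]]] //; rewrite ?f1 ?f2.
  have := fx (gsize w); rewrite pt => vw.
  case: f12 => -[f1 f2]; (have [f3E|f3E] : f 3 = 3 \/ f 3 = 4 by lia);
    rewrite f3E in fx vw.
  - apply: (word _ _ image_1); rewrite /= ?Dv ?Dw //; first by lia.
    by case=> [|[|[|x]]] //= xb; rewrite ?f1 ?f2 // fx ?swap12E; lia.
  - apply: (word _ _ image_d); rewrite /= ?gsz ?Dv ?Dw //; [lia|lia|].
    by case=> [|[|[|x]]] //= xb; rewrite ?f1 ?f2 // fx /bump ?swap12E; lia.
  - apply: (word _ _ image_t); rewrite /= ?Dv ?Dw //; first by lia.
    by case=> [|[|[|x]]] //= xb; rewrite ?f1 ?f2 // fx ?swap12E; lia.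
  - apply: (word _ _ image_td); rewrite /= ?gsz ?Dv ?Dw //; [lia|lia|].
    by case=> [|[|[|x]]] //= xb; rewrite ?f1 ?f2 // fx /bump /= ?swap12E; lia.
have f1_gt0 : (1 <= f 1) by have := pb 1; lia.
case Dv: (isD v) vb f_surj word step => vb f_surj word step; last first.
  have [f12 fx] : (f 1 <= 2) /\
      forall x, (1 <= x <= gsize w) -> f x = (f 1 + (x - 1)).
    apply: shift; rewrite ?gbaseE ?Dw //; first by lia.
    by case=> [|[|x]].
  have := fx (gsize w); rewrite pt => vw.
  have [f1E|f1E] : f 1 = 1 \/ f 1 = 2 by lia.
  - rewrite f1E in fx vw.
  apply: (word _ _ image_1); rewrite /= ?Dv ?Dw //; first by lia.
    by move=> x xb; rewrite fx; lia.
  - rewrite f1E in fx vw.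
  apply: (word _ _ image_a); rewrite /= ?gsz ?Dv ?Dw //; [lia|lia|].
    by move=> x xb; rewrite fx // /bump; lia.
(* From D to A: if [f 1] is 1 or 2, the shift starts at the vertex 2; otherwise it starts at 1 and
   both 1 and 2 of D_m are missed. *)
case: (leqP (f 1) 2) => f12.
  have [|_ /(_ isT) f2] := step 1; first by rewrite gbaseE Dw; lia.
  have [f23 fx] : (f 2 <= 4) /\
      forall x, (2 <= x <= gsize w) -> f x = (f 2 + (x - 2)).
    apply: shift; rewrite ?gbaseE ?Dw //; first by lia.
    by case=> [|[|x]] //; lia.
  have := fx (gsize w); rewrite pt => vw.
  (have [f1|f1] : f 1 = 1 \/ f 1 = 2 by lia);
    (have [f2E|f2E] : f 2 = 3 \/ f 2 = 4 by lia); rewrite f2E in fx vw.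
  - apply: (word _ _ image_c); rewrite /= ?gsz ?Dv ?Dw //; first by lia.
    by case=> [|[|x]] //= xb; rewrite ?f1 // fx /bump; lia.
  - apply: (word _ _ image_cd); rewrite /= ?gsz ?Dv ?Dw //; [lia|lia|].
    by case=> [|[|x]] //= xb; rewrite ?f1 // fx /bump; lia.
  - apply: (word _ _ image_ct); rewrite /= ?gsz ?Dv ?Dw //; first by lia.
    by case=> [|[|x]] //= xb; rewrite ?f1 // fx /bump /= ?swap12E; lia.
  - apply: (word _ _ image_ctd); rewrite /= ?gsz ?Dv ?Dw //; [lia|lia|].
    by case=> [|[|x]] //= xb; rewrite ?f1 // fx /bump /= ?swap12E; lia.
have [f13 fx] : (f 1 <= 4) /\
    forall x, (1 <= x <= gsize w) -> f x = (f 1 + (x - 1)).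
  apply: shift; rewrite ?gbaseE ?Dw //; first by lia.
  by case=> [|[|x]].
have := fx (gsize w); rewrite pt => vw.
have [f1E|f1E] : f 1 = 3 \/ f 1 = 4 by lia.
- rewrite f1E in fx vw.
  apply: (word _ _ image_ac); rewrite /= ?gsz ?Dv ?Dw //; [lia|lia|].
  by move=> x xb; rewrite fx // /bump; lia.
- rewrite f1E in fx vw.
  apply: (word _ _ image_acd); rewrite /= ?gsz ?Dv ?Dw //; [lia|lia|].
  by move=> x xb; rewrite fx // /bump; lia.
Qed.

Local Close Scope nat_scope.

Lemma word_normal ws b v : theta_image ws b -> wdom (ow ws) v ->
  normal v (wtgt (ow ws) v) (wfun (ow ws)).
Proof.
have := gsize_bounds v; case Dv: (isD v) => vb;
case; rewrite /normal /= ?gsz ?Dv //= ?gsz ?Dv /bump /= => dv; split=> i ib;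
  rewrite ?swap12E; try lia.
all: first [exists i; rewrite ?swap12E; lia | exists (i - 1)%N; rewrite ?swap12E; lia
  | exists (i - 2)%N; rewrite ?swap12E; lia | exists (i - 3)%N; rewrite ?swap12E; lia].
Qed.

End Correspondence.

(** * Values of the retraction on words *)

Section CorrespondenceValues.
Variables (k : comNzRingType) (F : fieldType) (n : nat).
Local Notation B := (kBQ k n).
Local Notation one := (one k F (n := n)).
Local Notation bE := (bE k (n := n)).
Local Notation bw := (bword k n).
Local Notation ow := (oword n).
Local Notation wv ws := (wval k F (ow ws)).
Local Notation theta := (theta (k := k) (F := F) (n := n)).

#[local] Arguments bword : simpl never.
Local Notation theta_image := (theta_image (k := k) (n := n)).
Let gsz := (isD_pred, isD_toA, gsize_pred, gsize_toA, gbaseE).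

Section Select.
Variables (R : pzRingType) (x z a b c : R).

Lemma select_subl : x * (a * z) = a * z -> x * (b * z) = 0 ->
  x * ((a - b) * z) = a * z.
Proof. by move=> xa xb; rewrite mulrBl mulrBr xa xb subr0. Qed.

Lemma select_subr : x * (a * z) = 0 -> x * (b * z) = b * z ->
  x * ((a - b) * z) = - b * z.
Proof. by move=> xa xb; rewrite mulrBl mulrBr xa xb sub0r mulNr. Qed.

Lemma select_addl : x * (a * z) = a * z -> x * (b * z) = 0 ->
  x * ((a + b) * z) = a * z.
Proof. by move=> xa xb; rewrite mulrDl mulrDr xa xb addr0. Qed.

Lemma select_addr : x * (a * z) = 0 -> x * (b * z) = b * z ->
  x * ((a + b) * z) = b * z.
Proof. by move=> xa xb; rewrite mulrDl mulrDr xa xb add0r. Qed.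

Lemma select_diff : x * (a * z) = a * z -> x * (b * z) = b * z ->
  x * (c * z) = 0 -> x * ((a - b - c) * z) = (a - b) * z.
Proof. by move=> xa xb xc; rewrite !(mulrBl, mulrBr) xa xb xc subr0. Qed.

Lemma select_last : x * (a * z) = 0 -> x * (b * z) = 0 ->
  x * (c * z) = c * z -> x * ((a - b - c) * z) = - c * z.
Proof.
by move=> xa xb xc; rewrite !(mulrBl, mulrBr) xa xb xc subr0 sub0r mulNr.
Qed.

End Select.

Lemma theta_word ws b v : theta_image ws b -> theta (wv ws * one v) = b * bE (bx v).
Proof.
have subM0 (R : pzRingType) (x y z : R) : x * z = 0 -> y * z = 0 -> (x - y) * z = 0.
  by move=> xz yz; rewrite mulrBl xz yz subr0.
move=> c; rewrite wval_one; case dv: (wdom _ v); last first.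
  rewrite raddf0; have bw0 ws' : wdom (ow ws') v = false -> bw ws' * bE (bx v) = 0.
    by move=> d; rewrite bword_target d.
  have bwN ws' : wdom (ow ws') v = false -> - bw ws' * bE (bx v) = 0.
    by move=> d; rewrite mulNr bw0 ?oppr0.
  case: c dv => d; apply: esym; first [exact: bw0 d | exact: bwN d | idtac].
  (* The value on the word ac has a second term cd, defined at the same vertices: the D_m with m >
     3. *)
  have d' : wdom (ow [:: Kc; Kd]) v = false.
    by move: d; rewrite /= ?gsz; have := gsize_bounds v; case: (isD v); lia.
  exact: subM0 (bw0 _ d) (bw0 _ d').
have := (wvalP k F (ow ws) (realizable_id v)).1 dv => rw.
rewrite (theta_cl k F rw) /theta_path; case: asboolP => [_|]; last first.
  by case; apply: word_normal c dv.
move E: (wtgt (ow ws) v) => w.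
have sel ws' : wdom (ow ws') v -> isD (wtgt (ow ws') v) = isD w ->
    gsize (wtgt (ow ws') v) = gsize w ->
    bE (bx w) * (bw ws' * bE (bx v)) = bw ws' * bE (bx v).
  by move=> d eD eS; rewrite bword_sandwich d (gam_vert_eq eD eS) eqxx.
have off ws' : (wdom (ow ws') v -> gsize (wtgt (ow ws') v) <> gsize w) ->
    bE (bx w) * (bw ws' * bE (bx v)) = 0.
  move=> ne; rewrite bword_sandwich ifF //; apply/andP => -[/ne] + /eqP.
  by move=> /[swap] ->.
have Dw : isD w = isD (wtgt (ow ws) v) by rewrite E.
have sw : gsize w = gsize (wtgt (ow ws) v) by rewrite E.
have vb := gsize_bounds v.
case Dv: (isD v) vb => vb; case: c dv Dw sw {E rw};
  rewrite /= ?gsz ?Dv /= => dv Dw sw; rewrite /normal_sum Dw ?Dv /=; try discriminate.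
- apply: select_subl; [apply: sel|apply: off];
    rewrite /= ?gsz ?Dv /= ?Dw ?sw //; lia.
- apply: select_subl; [apply: sel|apply: off];
    rewrite /= ?gsz ?Dv /= ?Dw ?sw //; lia.
- apply: select_subr; [apply: off|apply: sel];
    rewrite /= ?gsz ?Dv /= ?Dw ?sw //; lia.
- apply: select_subr; [apply: off|apply: sel];
    rewrite /= ?gsz ?Dv /= ?Dw ?sw //; lia.
- apply: select_subl; [apply: sel|apply: off];
    rewrite /= ?gsz ?Dv /= ?Dw ?sw //; lia.
- apply: select_subl; [apply: sel|apply: off];
    rewrite /= ?gsz ?Dv /= ?Dw ?sw //; lia.
- apply: select_subr; [apply: off|apply: sel];
    rewrite /= ?gsz ?Dv /= ?Dw ?sw //; lia.
- apply: select_subr; [apply: off|apply: sel];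
    rewrite /= ?gsz ?Dv /= ?Dw ?sw //; lia.
- apply: select_diff; [apply: sel|apply: sel|apply: off];
    rewrite /= ?gsz ?Dv /= ?Dw ?sw //; lia.
- apply: select_last; [apply: off|apply: off|apply: sel];
    rewrite /= ?gsz ?Dv /= ?Dw ?sw //; lia.
- apply: select_addl; [apply: sel|apply: off];
    rewrite /= ?gsz ?Dv /= ?Dw ?sw //; lia.
- apply: select_addr; [apply: off|apply: sel];
    rewrite /= ?gsz ?Dv /= ?Dw ?sw //; lia.
Qed.

End CorrespondenceValues.

(** * Words between two projectors *)

Section NormalizedWords.
Variables (R : pzRingType) (e T P1 P2 P3 C : R).
Hypothesis ee : e * e = e.
Hypothesis eT : e * T = T * e.
Hypothesis eP1 : e * (P1 * e) = P1 * e.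
Hypothesis eP2 : e * (P2 * e) = C.
Hypothesis eP3 : e * (P3 * e) = P3 * e.
Hypothesis P33 : P3 * e * (P3 * e) = 0.
Hypothesis P12 : P1 * e * C + C * (P3 * e) = P1 * P2 * e.

Let Ce : C * e = C. Proof. by rewrite -eP2 -!mulrA ee. Qed.
Let Te x : e * (T * x) = T * (e * x). Proof. by rewrite mulrA eT -mulrA. Qed.
Let ex x : e * (e * x) = e * x. Proof. by rewrite mulrA ee. Qed.
Let CE x : C * x = e * (P2 * (e * x)). Proof. by rewrite -eP2 -!mulrA. Qed.
Lemma nword_1 : e = e * 1 * e. Proof. by rewrite mulr1 ee. Qed.
Lemma nword_t : T * e * e = e * (T * 1) * e.
Proof. by rewrite mulr1 -!mulrA ee Te ee. Qed.
Lemma nword_d : - (- (P3 * e) * e) = e * (P3 * 1) * e.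
Proof. by rewrite mulNr opprK mulr1 -!mulrA ee eP3. Qed.
Lemma nword_td : - (T * e * (- (P3 * e) * e)) = e * (T * (P3 * 1)) * e.
Proof. by rewrite mulNr mulrN opprK mulr1 -!mulrA ee Te. Qed.
Lemma nword_a : P1 * e * e = e * (P1 * 1) * e.
Proof. by rewrite mulr1 -!mulrA ee eP1. Qed.
Lemma nword_c : C * e = e * (P2 * 1) * e.
Proof. by rewrite Ce mulr1 -mulrA eP2. Qed.
Lemma nword_ct : C * (T * e * e) = e * (P2 * (T * 1)) * e.
Proof. by rewrite mulr1 CE -!mulrA ee Te ee. Qed.
Lemma nword_cd : - (C * (- (P3 * e) * e)) = e * (P2 * (P3 * 1)) * e.
Proof. by rewrite mulNr mulrN opprK mulr1 CE -!mulrA ee eP3. Qed.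
Lemma nword_ctd : - (C * (T * e * (- (P3 * e) * e))) = e * (P2 * (T * (P3 * 1))) * e.
Proof. by rewrite mulNr !mulrN opprK mulr1 CE -!mulrA ee Te !eP3. Qed.
Let eP12 : e * (P1 * (P2 * e)) = P1 * (P2 * e).
Proof.
have eC : e * C = C by rewrite -eP2 ex.
by rewrite [P1 * _]mulrA -P12 mulrDr mulrA eP1 mulrA eC.
Qed.
Lemma nword_ac : P1 * e * (C * e) - C * (- (P3 * e) * e) = e * (P1 * (P2 * 1)) * e.
Proof. by rewrite mulNr mulrN opprK mulr1 Ce -!mulrA ee mulrA P12 -mulrA eP12. Qed.
(** In P1 e C = P1 P2 e - C P3 e the last term is killed by P3 e on the right, so no correction
    appears as it did for ac. *)
Lemma nword_acd : - (P1 * e * (C * (- (P3 * e) * e))) = e * (P1 * (P2 * (P3 * 1))) * e.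
Proof.
have P12' : P1 * e * C = P1 * P2 * e - C * (P3 * e) by rewrite -P12 addrK.
have -> : e * (P1 * (P2 * (P3 * 1))) * e = e * (P1 * (P2 * e)) * (P3 * e).
  by rewrite mulr1 -!mulrA eP3.
have -> : - (P1 * e * (C * (- (P3 * e) * e))) = P1 * e * C * (P3 * e).
  by rewrite mulNr !mulrN opprK -(mulrA P3) ee !mulrA.
by rewrite eP12 P12' mulrBl -(mulrA C) P33 mulr0 subr0 !mulrA.
Qed.

End NormalizedWords.

(** * Bijectivity and fullness *)

Section MainComparison.
Variables (k : comNzRingType) (F : fieldType) (n : nat).
Local Notation A := (kD1 k F n).
Local Notation B := (kBQ k n).
Local Notation one := (one k F (n := n)).
Local Notation cls := (cls k F (n := n)).
Local Notation ide := (ide k F n).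
Local Notation bE := (bE k (n := n)).
Local Notation bX := (bX k n).
Local Notation bw := (bword k n).
Local Notation wv ws := (wval k F (oword n ws)).
Local Notation theta := (theta (k := k) (F := F) (n := n)).
Local Notation theta_image := (theta_image (k := k) (n := n)).

Section Psi.
Variable psi : {additive B -> A}.
Hypothesis psiM : {morph psi : x y / x * y}.
Hypothesis psiZ : forall c x, psi (alg_map B c * x) = alg_map A c * psi x.
Hypothesis psi1 : psi 1 = ide.
Hypothesis psiE : forall x, psi (bE x) = one (gx x) * ide.
Hypothesis psiX : forall K, psi (bX K) = kval k F n K.

Lemma psi_word ws b : theta_image ws b -> psi b = ide * wv ws * ide.
Proof.
have ee := ide_idem k F n; have eT := ideT k F n; have eP1 := ideP1 k F n.
have eP2 := ideP2 k F n; have eP3 := ideP3 k F n.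
have P33 := eP3P3_ide k F n; have P12 := eP1P2_ide k F n.
have psiw ws' : psi (bw ws') = foldr (fun K x => kval k F n K * x) ide ws'.
  by elim: ws' => [|K ws' IH] //=; rewrite psiM psiX IH.
case; rewrite ?(raddfB psi) ?(raddfN psi).
- rewrite psiw /=; exact: nword_1 ee.
- rewrite psiw /=; exact: nword_t ee eT.
- rewrite psiw /=; exact: nword_d ee eP3.
- rewrite psiw /=; exact: nword_td ee eT.
- rewrite psiw /=; exact: nword_a ee eP1.
- rewrite psiw /=; exact: nword_c ee eP2.
- rewrite psiw /=; exact: nword_ct ee eT eP2.
- rewrite psiw /=; exact: nword_cd ee eP2 eP3.
- rewrite psiw /=; exact: nword_ctd ee eT eP2 eP3.
- rewrite (sub_congr (psiw [:: Ka; Kc]) (psiw [:: Kc; Kd])) /=.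
  exact: nword_ac ee eP1 eP2 P12.
- rewrite psiw /=; exact: nword_acd ee eP1 eP2 eP3 P33 P12.
Qed.

Lemma ide_cls_abnormal v w (p : qpath (@gam_arrow n) v w) :
  ~ normal v w (path_fun p) -> ide * cls p * ide = 0.
Proof.
have rp : realizable v w (path_fun p) by exists p.
move=> /not_andP[] /existsNP [i /not_implyP [iw]].
  move=> /contrapT fi; have up : eU k F n i * cls p = cls p.
    rewrite [in LHS]cls_cl oval_cl //= iw cls_cl; apply: cl_ext => x xb /=.
    by rewrite /nu; case: eqP => [->|] /=; rewrite ?subn0 // subn1 fi.
  by rewrite -up mulrA ide_eU !mul0r.
move=> fi; have pu : cls p * eU k F n i = cls p.
  rewrite -[in LHS](cls_one k F p) -mulrA one_eU oval_one /= iw.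
  rewrite cls_cl clM //; last exact: (oP (o := opU n i) iw).
  apply: cl_ext => x xb /=; rewrite /nu.
  case: eqP => [e|_]; last by rewrite subn0.
  by case: fi; exists x.
by rewrite -pu -!mulrA eU_ide !mulr0.
Qed.

Lemma psi_theta x : psi (theta x) = ide * x * ide.
Proof.
elim/configuration_ind: x => [|x y Sx Sy|c x Sx|v w p].
- by rewrite mulr0 mul0r !raddf0.
- by rewrite mulrDr mulrDl -Sx -Sy !raddfD.
- rewrite thetaZ psiZ Sx; apply: mul_sandwich; exact: alg_central.
case: (pselect (normal v w (path_fun p))) => np; last first.
  by rewrite ide_cls_abnormal // theta_cls /theta_path; case: asboolP => // _;
    rewrite raddf0.
have rp : realizable v w (path_fun p) by exists p.
have [ws [b [c e]]] := normal_word k F rp np.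
rewrite cls_cl e (theta_word F v c) psiM (psi_word c) psiE bxK.
by rewrite -!mulrA ide_beps.
Qed.

End Psi.

(** Under left multiplication by arrows, act is the only product that the relations other than
    [bACT] do not bring back to the eleven words; it is kept as a generator, and any further arrow
    kills it. *)
Inductive word_span : B -> Prop :=
| span_0 : word_span 0
| span_D x y : word_span x -> word_span y -> word_span (x + y)
| span_N x : word_span x -> word_span (- x)
| span_word ws b v : theta_image ws b -> word_span (bw ws * bE (bx v))
| span_act v : word_span (bw [:: Ka; Kc; Kt] * bE (bx v)).

Definition null_pair (K K' : bkind) : bool :=
  match K, K' with
  | Kt, (Ka | Kc) | Kd, (Ka | Kc | Kd) | Kc, (Ka | Kc) | Ka, (Kt | Kd | Ka) => true
  | _, _ => false
  end.

Lemma null_pairP K K' : null_pair K K' -> bX K * bX K' = 0.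
Proof.
have Tt := Tbtop k n; have Dt := Dbtop k n; have Ct := Cbtop k n.
have tA := btopA k n; have tC := btopC k n; have At := Abtop k n.
case: K; case: K' => np; try discriminate np; clear np.
- exact: XDD.
- exact: mul0_absl Dt tA.
- exact: mul0_absl Dt tC.
- exact: mul0_absr At (btopD k n).
- exact: XAA.
- exact: mul0_absr At (btopT k n).
- exact: mul0_absl Ct tA.
- exact: mul0_absl Ct tC.
- exact: mul0_absl Tt tA.
- exact: mul0_absl Tt tC.
Qed.

Lemma null_pair_span K K' ws v : null_pair K K' ->
  word_span (bX K * (bw (K' :: ws) * bE (bx v))).
Proof.
move=> /null_pairP e; rewrite (_ : bX K * _ = 0); first exact: span_0.
exact: mul0_assoc e.
Qed.

Lemma cons_span K ws b v : theta_image (K :: ws) b ->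
  word_span (bX K * (bw ws * bE (bx v))).
Proof.
move=> c; rewrite (_ : bX K * _ = bw (K :: ws) * bE (bx v)); last exact: mulrA.
exact: span_word c.
Qed.

Lemma bX_span K x : word_span x -> word_span (bX K * x).
Proof.
elim=> [|y z' _ Sy _ Sz|y _ Sy|ws b v|v].
- by rewrite mulr0; apply: span_0.
- by rewrite mulrDr; apply: span_D.
- by rewrite mulrN; apply: span_N.
- case=> {ws b}; case: K.
all: try by apply: null_pair_span.
all: try (eapply cons_span; constructor).
+ rewrite (mul_swap _ (XTD k n)); exact: span_word _ (image_td k n).
+ rewrite (mul_square _ (XTT k n)) btop_bE.
  case: (bx v) (span_word v (image_1 k n)) => j; last by move=> _; apply: span_0.
  by rewrite mul1r.
+ rewrite (mul_swap0 _ (XTD k n) (XDD k n)); exact: span_0.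
+ rewrite (mul_square_absorb _ (XTT k n) (btopD k n)).
  exact: span_word _ (image_d k n).
+ rewrite (_ : bX Ka * _ = bw [:: Ka; Kc; Kt] * bE (bx v)); last exact: mulrA.
  exact: span_act.
+ rewrite (mul_last _ (bACTD k n)); exact: span_word _ (image_acd k n).
- by apply: null_pair_span; case: K.
Qed.

Lemma bcls_span x y (p : qpath (@bq_arrow n) x y) : word_span (bcls k p).
Proof.
elim: p => [|u z a p IH]; last by rewrite bcls_pcons; apply: bX_span.
by have := span_word (gx x) (image_1 k n); rewrite gxK mul1r.
Qed.

Let theta_opp x : theta (- x) = - theta x. Proof. exact: raddfN. Qed.
Let theta_sub x y : theta (x - y) = theta x - theta y. Proof. exact: raddfB. Qed.

Lemma theta_surjective b : exists x, theta x = b.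
Proof.
have spanP y : word_span y -> exists x, theta x = y.
  elim=> [|y1 y2 _ [x1 e1] _ [x2 e2]|y1 _ [x1 e1]|ws c v C|v].
  - by exists 0; rewrite raddf0.
  - by exists (x1 + x2); rewrite raddfD -e1 -e2.
  - by exists (- x1); rewrite raddfN -e1.
  - have th ws' b' := @theta_word k F n ws' b' v.
    case: C; [exists (wv [::] * one v)|exists (wv [:: Kt] * one v)
      |exists (- (wv [:: Kd] * one v))|exists (- (wv [:: Kt; Kd] * one v))
      |exists (wv [:: Ka] * one v)|exists (wv [:: Kc] * one v)
      |exists (wv [:: Kc; Kt] * one v)|exists (- (wv [:: Kc; Kd] * one v))
      |exists (- (wv [:: Kc; Kt; Kd] * one v))
      |exists (wv [:: Ka; Kc] * one v - wv [:: Kc; Kd] * one v)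
      |exists (- (wv [:: Ka; Kc; Kd] * one v))].
    + exact: th (image_1 k n).
    + exact: th (image_t k n).
    + rewrite theta_opp (th _ _ (image_d k n)); exact: mul_opp2.
    + rewrite theta_opp (th _ _ (image_td k n)); exact: mul_opp2.
    + exact: th (image_a k n).
    + exact: th (image_c k n).
    + exact: th (image_ct k n).
    + rewrite theta_opp (th _ _ (image_cd k n)); exact: mul_opp2.
    + rewrite theta_opp (th _ _ (image_ctd k n)); exact: mul_opp2.
    (* The two classes have values ac - cd and - cd, whose difference is ac. *)
    + apply: etrans (theta_sub _ _) _.
      apply: etrans (sub_congr (th _ _ (image_ac k n)) (th _ _ (image_cd k n))) _.
      exact: (mul_subN (bw [:: Ka; Kc]) (bw [:: Kc; Kd]) (bE (bx v))).
    + rewrite theta_opp (th _ _ (image_acd k n)); exact: mul_opp2.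
  (* The values are ac - cd and - ctd, and act = (ac - cd) + ctd. *)
  - exists (wv [:: Ka; Kc] * one v - wv [:: Kc; Kt; Kd] * one v).
    apply: etrans (theta_sub _ _) _.
    apply: etrans (sub_congr (theta_word F v (image_ac k n))
      (theta_word F v (image_ctd k n))) _.
    apply: mul_act; exact: bACT.
rewrite -[b]iquot_repr; elim/path_algebra_ind: (repr _) =>
  [|y z [x1 e1] [x2 e2]|c y [x e]|x y p].
- by exists 0; rewrite !raddf0.
- by exists (x1 + x2); rewrite (raddfD (iquot_pi _)) /= -e1 -e2; apply: raddfD.
- by exists (alg_map A c * x); rewrite thetaZ e (rmorphM (iquot_pi _)).
- exact: spanP (bcls_span p).
Qed.

(* Each [iota_(i-1) pi_i] factors through a smaller vertex, so by induction on the
   size the ideal generated by the projector contains every vertex. *)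
Lemma ide_full : exists s : seq (A * A), 1 = \sum_(p <- s) p.1 * ide * p.2.
Proof.
pose J (x : A) := exists s : seq (A * A), x = \sum_(p <- s) p.1 * ide * p.2.
have J0 : J 0 by exists [::]; rewrite big_nil.
have JD x y : J x -> J y -> J (x + y).
  by move=> [s ->] [t ->]; exists (s ++ t); rewrite big_cat.
have JM a b x : J x -> J (a * x * b).
  move=> [s ->]; exists [seq (a * p.1, p.2 * b) | p <- s].
  by rewrite big_map mulr_sumr mulr_suml; apply: eq_bigr => p _; rewrite !mulrA.
have Je : J ide by exists [:: (1, 1)]; rewrite big_seq1 mul1r mulr1.
suff J1 v : J (one v).
  by rewrite -/(J 1) -(sum_one k F n); apply: big_ind => // v _; apply: J1.
have JM1 a x : J x -> J (a * x) by move=> /(JM a 1); rewrite mulr1.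
have [m] := ubnP (gsize v); elim: m v => // m IH v vm.
have Ju i : J (eU k F n i * one v).
  rewrite oval_one /=; case: ifP => // iv.
  have [q [p [e lt]]] := opU_factor iv; rewrite (cl_cls k F e) -cls_cat.
  rewrite -(one_cls k F p) mulrA; apply: JM; apply: IH; lia.
(* The difference lies in [J] because applying each factor 1 - u_i changes [one v] only modulo [J];
   the other summand contains [ide]. *)
rewrite -[one v](subrK (ide * one v)); apply: (JD).
  exact: (nidem_congr 2 n.+1 J0 JD JM1 Ju).
by rewrite -[ide]mul1r; apply: JM.
Qed.

End MainComparison.

Theorem proposition5p5 (k : idomainType) (k_PID : is_PID k) (F : fieldType)
    (n : nat) (n_ge2 : (2 <= n)%N) :
  morita_equivalent (kD1 k F n) (kBQ k n).
Proof.
have [psi [psiM psiZ psi1 psiE psiX]] := quiver_hom_kD1 k F n.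
have [s full] := ide_full k F n.
have psiK : cancel psi (theta (k := k) (F := F) (n := n)).
  move=> b; have [x <-] := theta_surjective F b.
  by rewrite (psi_theta psiM psiZ psi1 psiE psiX) theta_ider theta_ide.
apply: (corner_morita psiM psiZ _ psiK (s := s)) => [x|].
  by rewrite psi1 (psi_theta psiM psiZ psi1 psiE psiX).
by rewrite psi1.
Qed.
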